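(* Let $\rho_0$ be a nonnegative, locally bounded measurable function on $\mathbb{R}$ such that for some (hence every) $b\in\mathbb{R}$, $\lim_{r\to-\infty}|r|^{-1}\sup_{r\le x\le b}\rho_0(x)=0$, and define $u_0$ by $u_0(0)=0$ and $u_0(x)-u_0(y)=\int_y^x\rho_0(r)\,dr$ for all $y<x$. Let $z^n(\cdot)$, $n=1,2,3,\dots$, be Hammersley processes such that for each $n$, $z^n_0(0)=0$ with probability 1, and the variables $\eta^n_i(0)=z^n_i(0)-z^n_{i-1}(0)$, $i\in\mathbb{Z}$, are mutually independent and exponentially distributed with expectations $E[\eta^n_i(0)]=n\int_{(i-1)/n}^{i/n}\rho_0(x)\,dx$. Let $\zeta_n(x,t)=n^{-1/2}\{z^n_{[nx]}(nt)-nu(x,t)\}$, where $u$ is given by the Hopf–Lax formula with initial function $u_0$. Suppose the processes $\{z^n(\cdot)\}$ are constructed on a common probability space with a two-sided standard Brownian motion $B(\cdot)$ so that, with $\zeta(x,t)=\inf_{y\in I(x,t)}B\big(\int_0^y\rho_0^2(s)\,ds\big)$, the following hold: (1) for every compact $A\subseteq\mathbb{R}\times[0,\infty)$ that is finite or satisfies $y^-(x,t)=y^+(x,t)$ for all $(x,t)\in A$, $\lim_{n\to\infty}\sup_{(x,t)\in A}|\zeta_n(x,t)-\zeta(x,t)|=0$ a.s.; (2) for all $-\infty<a<b<\infty$, $0<T<\infty$, $1\le p<\infty$, $\lim_{n\to\infty}\sup_{0\le t\le T}\int_a^b|\zeta_n(x,t)-\zeta(x,t)|^p\,dx=0$ a.s.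 (Such a construction exists.) Define the random distributions $$\xi_n(t,\phi)=n^{-1/2}\sum_{i\in\mathbb{Z}}\phi(i/n)\big(\eta^n_i(nt)-\rho^n_i(t)\big),\qquad \xi(t,\phi)=-\int_{-\infty}^\infty\phi'(x)\zeta(x,t)\,dx$$ for compactly supported test functions $\phi$, where $\eta^n_i(t)=z^n_i(t)-z^n_{i-1}(t)$ and $\rho^n_i(t)=nu(i/n,t)-nu((i-1)/n,t)$. Fix $\tau<\infty$. Then almost surely $$\lim_{n\to\infty}\sup_{t\in[0,\tau]}R(\xi_n(t),\xi(t))=0 .$$ In particular, $\xi_n(\cdot)$ converges almost surely to $\xi(\cdot)$ on the path space $D([0,\infty),H^{-1}_{\rm loc}(\mathbb{R}))$.
   Context: Hammersley's process. Take a rate one homogeneous Poisson point process on $\mathbb{R}\times(0,\infty)$. A sequence of Poisson points $(x_1,t_1),\dots,(x_m,t_m)$ is increasing if $x_1<\cdots<x_m$ and $t_1<\cdots<t_m$. $\mathbf{L}((a,s),(b,t))$ is the maximal number of Poisson points on an increasing sequence contained in $(a,b]\times(s,t]$, and $\mathbf{\Gamma}((a,s),m,\tau)=\inf\{h>0:\mathbf{L}((a,s),(a+h,s+\tau))\ge m\}$. Given an initial configuration $(z_i(0):i\in\mathbb{Z})$, independent of the Poisson process and almost surely in $\mathcal{Z}=\{(z_i)\in\mathbb{R}^{\mathbb{Z}}: z_{i-1}\le z_i \text{ for all } i,\ \lim_{i\to-\infty}i^{-2}z_i=0\}$, Hammersley's process is $z_k(t)=\inf_{i:\,i\le k}\{z_i(0)+\mathbf{\Gamma}((z_i(0),0),k-i,t)\}$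 for $k\in\mathbb{Z}$, $t>0$. For each $n$, the process $z^n(\cdot)$ has the law obtained this way from the law of its initial configuration. Hopf–Lax formula. $g(x)=x^2/4$; $u(x,0)=u_0(x)$ and, for $t>0$, $u(x,t)=\inf_{y\le x}\{u_0(y)+t\,g((x-y)/t)\}$. The infimum is attained on the nonempty compact set $I(x,t)=\{y\le x: u(x,t)=u_0(y)+t\,g((x-y)/t)\}$; $I(x,0)=\{x\}$; $y^-(x,t)=\inf I(x,t)$, $y^+(x,t)=\sup I(x,t)$. Two-sided Brownian motion: $B(s)=B_1(s)$ for $s\ge0$, $B(s)=-B_2(-s)$ for $s<0$, with $B_1,B_2$ independent standard Brownian motions on $[0,\infty)$. Integrals $\int_0^y$ are signed. An exponential variable with expectation $0$ is the constant $0$. Function spaces. $H^1(\mathbb{R})$ is the Sobolev space with norm $\|v\|_{H^1(\mathbb{R})}=\|v\|_{L^2(\mathbb{R})}+\|v'\|_{L^2(\mathbb{R})}$; $H^{-1}(\mathbb{R})$ is its dual with the operator norm. For a distribution $F\in\mathcal{D}'$ and smooth $\chi$, $\chi F(\phi)=F(\chi\phi)$. $H^{-1}_{\rm loc}(\mathbb{R})=\{F\in\mathcal{D}':\chi F\in H^{-1}(\mathbb{R})\text{ for all }\chi\in C_c^\infty(\mathbb{R})\}$. Fix an increasing sequence $\chi_k\in C_c^\infty(\mathbb{R})$ with $\mathbf{1}_{[-k+1,k-1]}\le\chi_k\le\mathbf{1}_{(-k,k)}$. The metric is $R(F,G)=\sum_{k\ge1}2^{-k}\{1\wedge\|\chi_kF-\chi_kG\|_{H^{-1}(\mathbb{R})}\}$,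 under which $H^{-1}_{\rm loc}(\mathbb{R})$ is complete and separable. $t\mapsto\xi_n(t)$ is a random element of the Skorokhod space $D([0,\infty),H^{-1}_{\rm loc}(\mathbb{R}))$ and $t\mapsto\xi(t)$ of $C([0,\infty),H^{-1}_{\rm loc}(\mathbb{R}))$. *)

(* Defs.v *)
From HB Require Import structures.
From mathcomp Require Import all_boot all_order all_algebra.
From mathcomp Require Import all_classical all_reals all_analysis.
From mathcomp Require Import measurable_realfun.

Set Implicit Arguments.
Unset Strict Implicit.
Unset Printing Implicit Defensive.

Import Order.TTheory GRing.Theory Num.Theory.
Import numFieldNormedType.Exports.

Local Open Scope classical_set_scope.
Local Open Scope ring_scope.

Section Independence.
Context {R : realType} {d : measure_display} {Omega : measurableType d}.
Variable P : probability Omega R.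

Definition mutually_independent {I : eqType} {d' : measure_display}
    {T : measurableType d'} (X : I -> Omega -> T) : Prop :=
  forall (s : seq I) (A : I -> set T), uniq s ->
    (forall i, measurable (A i)) ->
    P (\big[setI/setT]_(i <- s) (X i @^-1` A i)) =
    (\prod_(i <- s) P (X i @^-1` A i))%E.

Definition sigma_process {I : Type} {d' : measure_display}
    {T : measurableType d'} (D : set I) (X : I -> Omega -> T)
    : set (set Omega) :=
  <<s [set E | exists i A, [/\ D i, measurable A & E = X i @^-1` A]] >>.

Definition independent_sigma (F G : set (set Omega)) : Prop :=
  forall A B, F A -> G B -> P (A `&` B) = (P A * P B)%E.

(* [m] is the expectation, not the rate; the case [m = 0] is the point mass
   at 0. *)
Definition exponential_law (m : R) (A : set R) : \bar R :=
  if m == 0 then \d_(0 : R) A else exponential_prob m^-1 A.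

Definition has_exponential_law (X : Omega -> R) (m : R) : Prop :=
  forall A : set R, measurable A -> P (X @^-1` A) = exponential_law m A.

End Independence.

(* The law of a process indexed by Z x [0,oo) is its image measure on the path
   space, with the sigma-algebra generated by the coordinates. *)
Definition coordinate_sigma (R : realType) : set (set (int -> R -> R)) :=
  <<s [set C | exists k t (A : set R),
        [/\ 0 <= t, measurable A & C = [set x | A (x k t)]]] >>.

Definition same_law (R : realType)
    (d : measure_display) (Omega : measurableType d) (P : probability Omega R)
    (d' : measure_display) (Omega' : measurableType d')
    (P' : probability Omega' R)
    (X : int -> R -> Omega -> R) (X' : int -> R -> Omega' -> R) : Prop :=
  [/\ forall k t, 0 <= t -> measurable_fun setT (X k t),
      forall k t, 0 <= t -> measurable_fun setT (X' k t) &
      forall C, coordinate_sigma C ->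
        P [set w | C (fun k t => X k t w)] =
        P' [set w | C (fun k t => X' k t w)]].

(* In this section the state space is the set [E], with metric [r]. *)

Section Paths.
Context {R : realType} {T : Type}.
Variables (E : set T) (r : T -> T -> \bar R).

Definition cadlag (x : R -> T) : Prop :=
  [/\ forall t, 0 <= t -> E (x t),
      forall t, 0 <= t -> (r (x s) (x t) @[s --> t^'+] --> 0%E) &
      forall t, 0 < t -> exists2 l, E l & (r (x s) l @[s --> t^'-] --> 0%E)].

Definition continuous_path (x : R -> T) : Prop :=
  (forall t, 0 <= t -> E (x t)) /\
  (forall t, 0 <= t ->
    (r (x s) (x t) @[s --> within `[0, +oo[ (nbhs t)] --> 0%E)).

Definition log_slope (lam : R -> R) : \bar R :=
  ereal_sup [set (`|ln ((lam p.2 - lam p.1) / (p.2 - p.1))|)%:E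
            | p in [set p : R * R | 0 <= p.1 < p.2]].

Definition time_change (lam : R -> R) : Prop :=
  [/\ forall s t, 0 <= s -> s < t -> lam s < lam t,
      lam @` `[0, +oo[ = `[0, +oo[%classic &
      (log_slope lam < +oo)%E].

Definition stopped_dist (x y : R -> T) (lam : R -> R) (v : R) : \bar R :=
  ereal_sup [set mine (r (x (Num.min t v)) (y (Num.min (lam t) v))) 1%E
            | t in `[0, +oo[].

(* the metric of Ethier and Kurtz (Markov Processes, Section 3.5), which
   defines the Skorokhod topology of D([0,oo), E) *)
Definition skorokhod_dist (x y : R -> T) : \bar R :=
  ereal_inf [set maxe (log_slope lam)
                   (\int[lebesgue_measure]_(v in `[0%R, +oo[)
                      ((expR (- v))%:E * stopped_dist x y lam v))%E
            | lam in [set lam | time_change lam]].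

Definition skorokhod_cvg (x_ : nat -> R -> T) (x : R -> T) : Prop :=
  [/\ forall n, (0 < n)%N -> cadlag (x_ n), cadlag x &
      (skorokhod_dist (x_ n) x @[n --> \oo] --> 0%E)].

End Paths.

Definition real_dist (R : realType) (a b : R) : \bar R := (`|a - b|)%:E.

Section LastPassage.
Context {R : realType}.
Variable pts : set (R * R).

Definition increasing_in (a s b t : R) (c : seq (R * R)) : Prop :=
  sorted (fun p q : R * R => (p.1 < q.1) && (p.2 < q.2)) c /\
  (forall p, p \in c -> [/\ pts p, a < p.1 <= b & s < p.2 <= t]).

Definition Lpath (a s b t : R) : \bar R :=
  ereal_sup [set ((size c)%:R)%:E | c in increasing_in a s b t].

Definition Gammapath (a s : R) (m : nat) (tau : R) : \bar R :=
  ereal_inf [set h%:E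
            | h in [set h : R | 0 < h /\ ((m%:R)%:E <= Lpath a s (a + h) (s + tau))%E]].

(* The infimum is finite almost surely for the configurations considered. *)
Definition hammersley (z0 : int -> R) (k : int) (t : R) : R :=
  if t <= 0 then z0 k else
  fine (ereal_inf [set ((z0 i)%:E + Gammapath (z0 i) 0 `|k - i|%N t)%E
                  | i in [set i : int | i <= k]]).

End LastPassage.

Definition plane_measure (R : realType) :=
  (@lebesgue_measure R \x @lebesgue_measure R)%E.

(* [Pi w] is the random set of points, and [N A] counts those in [A].
   [poisson_pmf] is wrong at rate 0, [poisson_prob] is not; its argument of
   type nat is a dummy. *)
Definition poisson_process (R : realType) (d : measure_display)
    (Omega : measurableType d) (P : probability Omega R)
    (Pi : Omega -> set (R * R)) : Prop :=
  let H := [set p : R * R | 0 < p.2] in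
  let N (A : set (R * R)) (w : Omega) : \bar R := counting (Pi w `&` A) in
  [/\ forall w, Pi w `<=` H,
      forall A, measurable A -> measurable_fun setT (N A),
      forall A, measurable A -> A `<=` H -> (plane_measure A < +oo)%E ->
        forall k : nat, P [set w | N A w = (k%:R)%:E] =
          poisson_prob (fine (plane_measure A)) 0%N [set k] &
      forall (m : nat) (A : 'I_m -> set (R * R)),
        (forall j, measurable (A j) /\ A j `<=` H) -> trivIset setT A ->
        mutually_independent P (fun j => N (A j))].

Definition configuration (R : realType) (z0 : int -> R) : Prop :=
  (forall i : int, z0 (i - 1) <= z0 i) /\
  (z0 (- k%:Z) / k%:R ^+ 2 @[k --> \oo] --> (0 : R)).

(* [z k t w] is the position of particle [k] at time [t]. The process is a
   random element of a space of right-continuous paths with left limits, and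
   its law is the one produced by the graphical construction, carried out on
   some probability space. *)
Definition hammersley_process (R : realType) (d : measure_display)
    (Omega : measurableType d) (P : probability Omega R)
    (z : int -> R -> Omega -> R) : Prop :=
  {ae P, forall w, forall k, cadlag setT (@real_dist R) (fun t => z k t w)} /\
  exists (d' : measure_display) (Omega' : measurableType d')
    (P' : probability Omega' R) (Pi : Omega' -> set (R * R))
    (z0 : int -> Omega' -> R),
    [/\ poisson_process P' Pi,
        forall i, measurable_fun setT (z0 i),
        {ae P', forall w, configuration (fun i => z0 i w)},
        independent_sigma P'
          (sigma_process [set A : set (R * R) | measurable A]
             (fun A w => counting (Pi w `&` A) : \bar R))
          (sigma_process setT z0) &
        same_law P P' z
          (fun k t w => hammersley (Pi w) (fun i => z0 i w) k t)].

Section HopfLax.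
Context {R : realType}.

Definition signed_integral (f : R -> R) (a b : R) : R :=
  if a <= b then \int[lebesgue_measure]_(x in `[a, b]) f x
  else - (\int[lebesgue_measure]_(x in `[b, a]) f x).

Definition g (x : R) : R := x ^+ 2 / 4.

Variable u0 : R -> R.

Definition hopf_lax (x t : R) : R :=
  if t <= 0 then u0 x else
  inf [set u0 y + t * g ((x - y) / t) | y in [set y | y <= x]].

Definition minimizers (x t : R) : set R :=
  if t <= 0 then [set x] else
  [set y | y <= x /\ hopf_lax x t = u0 y + t * g ((x - y) / t)].

Definition yminus (x t : R) : R := inf (minimizers x t).
Definition yplus (x t : R) : R := sup (minimizers x t).

End HopfLax.

Section Brownian.
Context {R : realType} {d : measure_display} {Omega : measurableType d}.
Variable P : probability Omega R.

Definition brownian (W : R -> Omega -> R) : Prop :=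
  [/\ forall t, 0 <= t -> measurable_fun setT (W t),
      {ae P, forall w, W 0 w = 0},
      forall s t, 0 <= s -> s < t -> forall A : set R, measurable A ->
        P [set w | A (W t w - W s w)] = normal_prob 0 (Num.sqrt (t - s)) A,
      forall (m : nat) (t : nat -> R), 0 <= t 0%N ->
        (forall i, t i <= t i.+1) ->
        mutually_independent P
          (fun (j : 'I_m) w => W (t j.+1) w - W (t j) w) &
      {ae P, forall w, {within `[0, +oo[, continuous (fun t => W t w)}}].

Definition two_sided_brownian (B : R -> Omega -> R) : Prop :=
  exists B1 B2 : R -> Omega -> R,
    [/\ brownian B1, brownian B2,
        independent_sigma P
          (sigma_process [set t : R | 0 <= t] B1)
          (sigma_process [set t : R | 0 <= t] B2) &
        forall w, (forall s, 0 <= s -> B s w = B1 s w) /\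
                  (forall s, s < 0 -> B s w = - B2 (- s) w)].

End Brownian.

Section Distributions.
Context {R : realType}.
Notation mu := (@lebesgue_measure R).

Definition smooth (f : R -> R) : Prop :=
  forall (j : nat) (x : R), derivable (derive1n j f) x 1.

Definition test (f : R -> R) : Prop :=
  smooth f /\ compact (closure [set x | f x != 0]).

(* Distributions are represented by functionals on all functions, of which only
   the values at test functions matter. *)
Definition distribution_on_R (F : (R -> R) -> R) : Prop :=
  (forall (a : R) (f h : R -> R), test f -> test h ->
     F (fun x => a * f x + h x) = a * F f + F h) /\
  (forall K : set R, compact K -> exists (C : R) (m : nat),
     forall f, test f -> (forall x, ~ K x -> f x = 0) ->
       `|F f| <= C * \sum_(j < m.+1) sup [set `|derive1n j f x| | x in setT]).

Definition mulD (chi : R -> R) (F : (R -> R) -> R) : (R -> R) -> R :=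
  fun f => F (fun x => chi x * f x).

Definition subD (F G : (R -> R) -> R) : (R -> R) -> R := fun f => F f - G f.

Definition L2norm (v : R -> R) : \bar R := 'N[mu]_2%:E[EFin \o v]%E.

Definition L2 : set (R -> R) :=
  [set v | measurable_fun setT v /\ (L2norm v < +oo)%E].

Definition weak_derivatives (v : R -> R) : set (R -> R) :=
  [set w | L2 w /\ forall f, test f ->
     \int[mu]_x (v x * derive1 f x) = - \int[mu]_x (w x * f x)].

Definition H1 : set (R -> R) :=
  [set v | L2 v /\ weak_derivatives v !=set0].

Definition weak_derivative (v : R -> R) : R -> R := get (weak_derivatives v).

Definition H1norm (v : R -> R) : \bar R :=
  (L2norm v + L2norm (weak_derivative v))%E.

Definition linear_on_H1 (G : (R -> R) -> R) : Prop :=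
  forall (a : R) (v w : R -> R), H1 v -> H1 w ->
    G (fun x => a * v x + w x) = a * G v + G w.

Definition operator_norm (G : (R -> R) -> R) : \bar R :=
  ereal_sup [set (`|G v|)%:E | v in [set v | H1 v /\ (H1norm v <= 1)%E]].

(* the linear functionals on H^1(R) that agree with [F] on test functions *)
Definition H1_extensions (F : (R -> R) -> R) : set ((R -> R) -> R) :=
  [set G | linear_on_H1 G /\ forall f, test f -> G f = F f].

Definition Hminus1 (F : (R -> R) -> R) : Prop :=
  exists2 G, H1_extensions F G & (operator_norm G < +oo)%E.

(* The bounded extension of [F] is unique because test functions are dense in
   H^1(R), so the infimum is its operator norm; it is +oo outside H^{-1}(R). *)
Definition Hminus1_norm (F : (R -> R) -> R) : \bar R :=
  ereal_inf [set operator_norm G | G in H1_extensions F].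

Definition Hminus1_loc : set ((R -> R) -> R) :=
  [set F | distribution_on_R F /\ forall chi, test chi -> Hminus1 (mulD chi F)].

Definition cutoffs (chi : nat -> R -> R) : Prop :=
  forall k, (0 < k)%N ->
    [/\ test (chi k), forall x, chi k x <= chi k.+1 x &
        forall x, \1_(`[- k%:R + 1, k%:R - 1]%classic) x <= chi k x
                  <= \1_(`]- k%:R, k%:R[%classic) x].

Definition Rmetric (chi : nat -> R -> R) (F G : (R -> R) -> R) : \bar R :=
  (\sum_(1 <= k <oo) ((2 ^- k)%:E *
     mine 1 (Hminus1_norm (subD (mulD (chi k) F) (mulD (chi k) G)))))%E.

End Distributions.

Section Fluctuations.
Context {R : realType} {Omega : Type}.
Variables (rho0 u0 : R -> R) (z : nat -> int -> R -> Omega -> R)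
  (B : R -> Omega -> R).

Definition eta (n : nat) (i : int) (t : R) (w : Omega) : R :=
  z n i t w - z n (i - 1) t w.

Definition rho (n : nat) (i : int) (t : R) : R :=
  n%:R * hopf_lax u0 (i%:~R / n%:R) t
  - n%:R * hopf_lax u0 ((i - 1)%:~R / n%:R) t.

Definition zeta_n (n : nat) (x t : R) (w : Omega) : R :=
  (Num.sqrt n%:R)^-1 *
  (z n (Num.floor (n%:R * x)) (n%:R * t) w - n%:R * hopf_lax u0 x t).

Definition zeta (x t : R) (w : Omega) : R :=
  inf [set B (signed_integral (fun s => rho0 s ^+ 2) 0 y) w
      | y in minimizers u0 x t].

Definition xi_n (w : Omega) (n : nat) (t : R) (f : R -> R) : R :=
  (Num.sqrt n%:R)^-1 *
  \sum_(i \in [set: int])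
     (f (i%:~R / n%:R) * (eta n i (n%:R * t) w - rho n i t)).

Definition xi (w : Omega) (t : R) (f : R -> R) : R :=
  - \int[lebesgue_measure]_x (derive1 f x * zeta x t w).

End Fluctuations.

(* Main.v *)
(* Summation by parts turns xi_n(t, f) into - \int f' zeta_n^, where zeta_n^ is
   zeta_n with x rounded down to the lattice Z/n. Hence xi_n(t) - xi(t) is the
   distributional derivative of zeta_n^ - zeta, and its localized H^{-1} norms
   are at most local L^2 norms of zeta_n^ - zeta. The Hopf-Lax solution is
   locally Lipschitz, so rounding costs O(n^{-1/2}), and hypothesis (2) with
   p = 2 gives the uniform convergence.

   For the path properties, zeta(x, t) is the minimum of a continuous function
   over the minimizers I(x, t). These are monotone in x, so for fixed t they are
   singletons off a countable set of shocks; there zeta(x, s) -> zeta(x, t) as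
   s -> t, and dominated convergence makes xi continuous in time. Uniform
   convergence on compact time intervals bounds the Skorokhod distance through
   the identity time change. *)

(* The norm of H^1(R) is built on a weak derivative picked by [get], which is neither linear nor
   equal to the classical derivative on the nose. Bounding an H^{-1} norm requires an actual linear
   extension to H^1(R), hence almost everywhere uniqueness of weak derivatives, hence the du
   Bois-Reymond lemma. The bump it rescales is the first cutoff, so no smooth function has to be
   constructed. Functionals are tested against C^1 functions of compact support, a class stable
   under multiplication by cutoffs after one use of the Leibniz rule. Randomness is confined to the
   choice of one almost sure event, on which the Brownian path is continuous, the particle paths are
   right-continuous with left limits, and (2) holds with p = 2 on all integer boxes; the rest is
   deterministic. The growth condition on [rho0] is used once, to produce boxes: for |x| <= K and t
   <= T all minimizers lie in a fixed compact interval on which [u0] is Lipschitz. *)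
Require Import Defs.
From mathcomp Require Import all_boot all_order all_algebra.
From mathcomp Require Import all_classical all_reals all_analysis.
From mathcomp Require Import measurable_realfun.
From mathcomp Require Import zify ring lra.

Set Implicit Arguments.
Unset Strict Implicit.
Unset Printing Implicit Defensive.

Import Order.TTheory GRing.Theory Num.Theory.
Import numFieldNormedType.Exports.

Local Open Scope classical_set_scope.
Local Open Scope ring_scope.

(** * Integrability criteria for Lebesgue measure *)

Section LebesgueIntegrability.
Context {R : realType}.
Notation mu := (@lebesgue_measure R).
Implicit Types (D : set R) (f g : R -> R).

Lemma itv_finite_measure (a b : R) : (mu `[a, b] < +oo)%E.
Proof. by rewrite lebesgue_measure_itv/=; case: ifP => //; rewrite ltry. Qed.

Lemma integrable_measurable D f : mu.-integrable D (EFin \o f) -> measurable_fun D f.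
Proof. by case/integrableP => /measurable_EFinP. Qed.

Lemma integrable_dominated D f g : measurable D -> measurable_fun D f ->
  (forall x, D x -> `|f x| <= g x) -> mu.-integrable D (EFin \o g) ->
  mu.-integrable D (EFin \o f).
Proof.
move=> mD mf fg; apply: le_integrable => //; first exact/measurable_EFinP.
by move=> x Dx /=; rewrite lee_fin (le_trans (fg x Dx))// ler_norm.
Qed.

Lemma integrable_fin_bounded D f (M : R) : measurable D -> (mu D < +oo)%E ->
  measurable_fun D f -> (forall x, D x -> `|f x| <= M) ->
  mu.-integrable D (EFin \o f).
Proof.
move=> mD D_fin mf fM; apply: measurable_bounded_integrable => //.
exists M; split; first exact: num_real.
by move=> N MN x Dx; rewrite /= (le_trans (fM x Dx))// ltW.
Qed.

Lemma integrable_itv_bounded (a b : R) f (M : R) : measurable_fun `[a, b] f ->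
  (forall x, x \in `[a, b] -> `|f x| <= M) -> mu.-integrable `[a, b] (EFin \o f).
Proof. by move=> mf fM; apply: (@integrable_fin_bounded _ _ M) => //; exact: itv_finite_measure. Qed.

Lemma integrable_cst_fin D (k : R) : measurable D -> (mu D < +oo)%E ->
  mu.-integrable D (EFin \o cst k).
Proof. by move=> mD D_fin; exact: (@integrable_fin_bounded _ _ `|k|). Qed.

Lemma integrable_add D f g : measurable D -> mu.-integrable D (EFin \o f) ->
  mu.-integrable D (EFin \o g) -> mu.-integrable D (EFin \o (fun x => f x + g x)).
Proof. by move=> mD iF ig; exact: (@integrableD _ _ _ mu D mD _ _ iF ig). Qed.

Lemma integrable_scale D (k : R) f : measurable D -> mu.-integrable D (EFin \o f) ->
  mu.-integrable D (EFin \o (fun x => k * f x)).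
Proof. by move=> mD iF; exact: (@integrableZl _ _ _ mu D mD k _ iF). Qed.

Lemma integrable_sub D f g : measurable D -> mu.-integrable D (EFin \o f) ->
  mu.-integrable D (EFin \o g) -> mu.-integrable D (EFin \o (fun x => f x - g x)).
Proof.
move=> mD iF ig; have := integrable_add mD iF (integrable_scale (-1) mD ig).
by apply: eq_integrable => // x _ /=; rewrite mulN1r.
Qed.

Lemma integrable_mul_bounded D f g (M : R) : measurable D ->
  mu.-integrable D (EFin \o f) -> measurable_fun D g ->
  (forall x, D x -> `|g x| <= M) -> mu.-integrable D (EFin \o (fun x => f x * g x)).
Proof.
move=> mD iF mg gM.
apply: (@integrable_dominated _ _ (fun x => M * `|f x|)) => //.
- by apply: measurable_funM => //; exact: integrable_measurable.
- by move=> x Dx; rewrite normrM mulrC ler_wpM2r// gM.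
- by apply: integrable_scale => //; exact: (@integrable_norm _ _ _ mu D _ iF).
Qed.

Lemma Rintegral_support D f : (forall x, ~ D x -> f x = 0) ->
  \int[mu]_x f x = \int[mu]_(x in D) f x.
Proof.
move=> f0; rewrite [RHS]Rintegral_mkcond; congr Rintegral; apply/funext => x.
by rewrite /patch; case: ifPn => // /negP; rewrite inE => /f0.
Qed.

End LebesgueIntegrability.

(** * Compactly supported C^1 functions and integration by parts *)

Section CompactlySupportedC1.
Context {R : realType}.
Notation mu := (@lebesgue_measure R).
Implicit Types (a b : R) (f g h : R -> R).

(** A single continuous derivative is all that the H^{-1} estimates use, and it keeps products such
    as [chi * f] in the class without any higher Leibniz formula. The radius [a] is explicit because
    it becomes the domain of integration. *)
Definition C1c a f := [/\ forall x, derivable f x 1, continuous (derive1 f)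
  & forall x, a <= `|x| -> f x = 0].

Lemma derivable_continuous f : (forall x, derivable f x 1) -> continuous f.
Proof.
by move=> df x; apply: differentiable_continuous; apply/derivable1_diffP.
Qed.

Lemma smooth_derivable f x : smooth f -> derivable f x 1.
Proof. by move=> /(_ 0%N x). Qed.

Lemma smooth_continuous f : smooth f -> continuous f.
Proof. by move=> sf; apply: derivable_continuous => x; exact: smooth_derivable. Qed.

Lemma smooth_derive1_continuous f : smooth f -> continuous (derive1 f).
Proof. by move=> sf; apply: derivable_continuous => x; exact: (sf 1%N). Qed.

Lemma test_support f : test f -> exists2 a : R, 0 < a & forall x, a <= `|x| -> f x = 0.
Proof.
move=> [_ /compact_bounded [M [_ HM]]].
exists (`|M| + 1); first by rewrite ltr_wpDl.
move=> x Mx; apply/eqP; apply: contraT => fx.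
(* [compact_bounded] bounds the support by every number above [M]; this one is above [M] and still
   below [|M| + 1]. *)
have := HM (`|M| + 1/2) _ x; rewrite /= => /(_ _ _)/wrap[].
  by rewrite (le_lt_trans (ler_norm _))// ltrDl.
  exact: subset_closure.
move=> h; have := le_trans Mx h; lra.
Qed.

Lemma test_C1c f : test f -> exists2 a : R, 0 < a & C1c a f.
Proof.
move=> tf; have [a a0 fa] := test_support tf; exists a => //.
case: tf => sf _; split => //; first by move=> x; exact: smooth_derivable.
exact: smooth_derive1_continuous.
Qed.

Lemma C1cW a b f : a <= b -> C1c a f -> C1c b f.
Proof. by move=> ab [? ? fa]; split => // x bx; rewrite fa// (le_trans ab). Qed.

Lemma derive1M f g x : derivable f x 1 -> derivable g x 1 ->
  derive1 (fun y => f y * g y) x = derive1 f x * g x + f x * derive1 g x.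
Proof.
move=> df dg; rewrite !derive1E; transitivity ('D_1 (f * g) x) => //.
have -> := deriveM df dg; rewrite addrC; congr (_ + _).
exact: mulrC.
Qed.

Lemma C1cM a f g : C1c a f -> (forall x, derivable g x 1) ->
  continuous (derive1 g) -> C1c a (fun x => f x * g x).
Proof.
move=> [df cf fa] dg cg; split.
- by move=> x; exact: derivableM.
- rewrite (_ : derive1 _ = fun x => derive1 f x * g x + f x * derive1 g x).
    move=> x; apply: cvgD; apply: cvgM.
    + exact: cf.
    + exact: (derivable_continuous dg).
    + exact: (derivable_continuous df).
    + exact: cg.
  by apply/funext => x; exact: derive1M.
- by move=> x ax; rewrite fa// mul0r.
Qed.

(** Strictness puts [x] in an open set on which [f] vanishes, so that [f] can be compared with a
    constant near [x]. *)
Lemma C1c_derive1_out a f x : C1c a f -> a < `|x| -> derive1 f x = 0.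
Proof.
move=> [_ _ fa] ax; rewrite -(@derive1_cst _ R^o 0 x) !derive1E.
apply: near_eq_derive.
have : \forall y \near x, a < `|y|.
  have : continuous (fun y : R => `|y|) by move=> ?; exact: norm_continuous.
  by move=> /(_ x)/cvgr_gt; exact.
by apply: filterS => y /ltW/fa.
Qed.

Lemma C1c_continuous a f : C1c a f -> continuous f.
Proof. by case=> df _ _; exact: derivable_continuous. Qed.

Lemma bounded_support a f : 0 < a -> continuous f ->
  (forall x, a < `|x| -> f x = 0) -> exists2 M : R, 0 < M & forall x, `|f x| <= M.
Proof.
move=> a0 cf fa.
have ab : - a <= a by lra.
have cfa : {within `[- a, a], continuous (fun x => `|f x|)}.
  apply: continuous_subspaceT => x; apply: continuous_comp; first exact: cf.
  exact: norm_continuous.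
have [c _ Hc] := EVT_max ab cfa.
exists (`|f c| + 1); first by rewrite ltr_wpDl.
move=> x; have [ax|ax] := leP `|x| a.
  by apply: (le_trans (Hc _ _)); [rewrite in_itv/= -ler_norml|rewrite lerDl].
by rewrite fa// normr0 addr_ge0.
Qed.

Lemma C1c_bounded a f : 0 < a -> C1c a f -> exists2 M : R, 0 < M &
  forall x, `|f x| <= M /\ `|derive1 f x| <= M.
Proof.
move=> a0 Cf.
have [M M0 HM] : exists2 M : R, 0 < M & forall x, `|f x| <= M.
  apply: (@bounded_support a) => //; first exact: C1c_continuous Cf.
  by move=> x /ltW; case: Cf => _ _; exact.
have [N N0 HN] : exists2 M : R, 0 < M & forall x, `|derive1 f x| <= M.
  apply: (@bounded_support a) => //; first by case: Cf.
  by move=> x; exact: C1c_derive1_out.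
exists (M + N); first exact: addr_gt0.
by move=> x; split; [rewrite (le_trans (HM x))// lerDl ltW
  |rewrite (le_trans (HN x))// lerDr ltW].
Qed.

Lemma Rintegral_derive1 f a b : a <= b -> (forall x, derivable f x 1) ->
  continuous (derive1 f) -> \int[mu]_(x in `[a, b]) derive1 f x = f b - f a.
Proof.
move=> + df cf; rewrite le_eqVlt => /predU1P[<-|ab].
  by rewrite set_itv1 Rintegral_set1 subrr.
have LR : derivable_oo_LRcontinuous f a b.
  split; first by move=> x _.
    by apply: cvg_at_right_filter; exact: (derivable_continuous df).
  by apply: cvg_at_left_filter; exact: (derivable_continuous df).
have cf' : {within `[a, b], continuous (derive1 f)} by exact: continuous_subspaceT.
have H := @continuous_FTC2 R (derive1 f) f a b ab cf' LR (fun x _ => erefl).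
by rewrite /Rintegral H.
Qed.

(** Both supports lie in [-(a+b), a+b], and [f] vanishes at its ends, so no boundary term
    survives. *)
Lemma C1c_by_parts a b f g : 0 < a -> 0 < b -> C1c a f -> C1c b g ->
  \int[mu]_x (f x * derive1 g x) = - \int[mu]_x (derive1 f x * g x).
Proof.
move=> a0 b0 Cf Cg; pose c := a + b.
have c0 : 0 < c by exact: addr_gt0.
have {}Cf : C1c c f by apply: C1cW Cf; rewrite lerDl ltW.
have {}Cg : C1c c g by apply: C1cW Cg; rewrite lerDr ltW.
have notin x : ~ `[- c, c]%classic x -> c < `|x|.
  by rewrite /= in_itv/= -ler_norml ltNge => /negP.
rewrite !(@Rintegral_support _ `[- c, c]); last 2 first.
- by move=> x /notin/ltW; case: Cg => _ _ /[apply] ->; rewrite mulr0.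
- by move=> x /notin/ltW; case: Cf => _ _ /[apply] ->; rewrite mul0r.
have LR h : C1c c h -> derivable_oo_LRcontinuous h (- c) c.
  move=> [dh _ _]; split => //.
    by apply: cvg_at_right_filter; exact: (derivable_continuous dh).
  by apply: cvg_at_left_filter; exact: (derivable_continuous dh).
rewrite (@Rintegration_by_parts _ f g (derive1 f) (derive1 g)) //.
- case: Cf => _ _ fc; rewrite !fc ?mul0r ?subr0 ?sub0r// ?normrN ger0_norm//; exact: ltW.
- lra.
- by apply: continuous_subspaceT; case: Cf.
- exact: LR.
- by apply: continuous_subspaceT; case: Cg.
- exact: LR.
Qed.

End CompactlySupportedC1.

(** * Convergence to 0 in the extended reals *)

Section ErealLimits.
Context {R : realType}.

Lemma near_lt_cvg0e (T : Type) (F : set_system T) (f : T -> \bar R) (e : R) :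
  Filter F -> f x @[x --> F] --> 0%E -> 0 < e -> \forall x \near F, (f x < e%:E)%E.
Proof.
move=> FF /(_ [set y | y < e%:E]%E) h e0; apply: h.
by apply: open_nbhs_nbhs; split; [exact: open_ereal_lt_ereal|rewrite /= lte_fin].
Qed.

Lemma cvg0e_near_le (T : Type) (F : set_system T) (f : T -> \bar R) :
  Filter F -> (forall x, 0 <= f x)%E ->
  (forall e : R, 0 < e -> \forall x \near F, (f x <= e%:E)%E) ->
  f x @[x --> F] --> 0%E.
Proof.
move=> FF f0 fe U; rewrite /nbhs/= /ereal_nbhs/= => /nbhs_ballP[e /= e0 He].
have := fe (e / 2); rewrite divr_gt0// => /(_ isT).
apply: filterS => x; rewrite /preimage/=; have := f0 x; case: (f x) => [r| |]//.
rewrite !lee_fin => r0 re; apply: He; rewrite /ball/= sub0r normrN ger0_norm//.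
by apply: (le_lt_trans re); rewrite ltr_pdivrMr// ltr_pMr// ltr1n.
Qed.

End ErealLimits.

(** * Rescaled bumps and the du Bois-Reymond lemma *)

Section TestRescaling.
Context {R : realType}.
Notation mu := (@lebesgue_measure R).
Implicit Types (f : R -> R) (c y : R).

Lemma derive1_affine f c y x : derivable f (c * (x - y)) 1 ->
  is_derive x 1 (fun x => f (c * (x - y))) (c * derive1 f (c * (x - y))).
Proof.
move=> df.
have h : is_derive x 1 (fun x : R => c * (x - y)) c.
  rewrite (_ : (fun x : R => c * (x - y)) = (c \*: (id - cst y))%R)//.
  by apply: is_derive_eq; rewrite subr0 /GRing.scale/= mulr1.
have dff : is_derive (c * (x - y)) 1 f (derive1 f (c * (x - y))).
  by rewrite derive1E; exact/derivableP.
have := is_derive1_comp (g := fun x : R => c * (x - y)) dff h.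
by rewrite mulrC.
Qed.

Lemma derive1n_affine f c y j : smooth f ->
  derive1n j (fun x => f (c * (x - y))) = fun x => c ^+ j * derive1n j f (c * (x - y)).
Proof.
move=> sf; elim: j => [|j IH]; first by apply/funext => x; rewrite mul1r.
rewrite derive1nS IH; apply/funext => x; rewrite derive1E.
have := @derive1_affine (derive1n j f) c y x (sf j _) => h.
have -> : (fun x0 => c ^+ j * derive1n j f (c * (x0 - y))) =
  c ^+ j *: (fun x0 => derive1n j f (c * (x0 - y))) by [].
rewrite deriveZ; last by case: h.
by rewrite (@derive_val _ _ _ _ _ _ _ h) -derive1nS /GRing.scale/= mulrA exprSr.
Qed.

Lemma smooth_affine f c y : smooth f -> smooth (fun x => f (c * (x - y))).
Proof.
move=> sf j x; rewrite derive1n_affine//.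
have [h _] := @derive1_affine (derive1n j f) c y x (sf j _).
exact: (derivableZ h).
Qed.

Lemma test_affine f c y : 0 < c -> test f -> test (fun x => f (c * (x - y))).
Proof.
move=> c0 tf; split; first by apply: smooth_affine; case: tf.
have [a a0 fa] := test_support tf.
apply: (@subclosed_compact _ _ `[y - a / c, y + a / c]).
- exact: closed_closure.
- exact: segment_compact.
- rewrite [X in _ `<=` X](closure_id _).1; last exact: interval_closed.
  apply: closureS => x /= fx; rewrite in_itv/= -ler_distl.
  rewrite leNgt; apply/negP => h; move/eqP: fx; apply; apply: fa.
  by rewrite normrM (gtr0_norm c0) mulrC -ler_pdivrMr// ltW.
Qed.

Lemma negligible_ae_eq (w : R -> R) (N : set R) : mu.-negligible N ->
  (forall x, ~ N x -> w x = 0) -> ae_eq mu setT w (cst 0).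
Proof.
move=> nN wN; apply: negligibleS nN => x /= h; apply: contrapT => /wN wx.
by apply: h => _.
Qed.

(* At a Lebesgue point y, testing w against bumps of width r around y bounds
   |w y| r by the integral of |w - w y| over the ball, which is o(r). *)
Lemma du_bois_reymond (bump w : R -> R) :
  test bump -> (forall x, 0 <= bump x <= 1) -> bump 0 = 1 ->
  (forall x, 1 <= `|x| -> bump x = 0) ->
  locally_integrable setT w ->
  (forall f, test f -> \int[mu]_x (w x * f x) = 0) ->
  ae_eq mu setT w (cst 0).
Proof.
move=> tb b01 b0 bs lw wf.
apply: (negligible_ae_eq (lebesgue_differentiation lw)) => y /contrapT wy.
have cb : continuous bump by apply: smooth_continuous; case: tb.
(* The bump is at least 1/2 on [-dl, dl]. After rescaling to width r this set has length 2 dl r, so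
   the integral of the bump is at least dl r. *)
have [dl dl0 Hdl] : exists2 dl : R, 0 < dl & forall x, `|x| <= dl -> 2^-1 <= bump x.
  have : \forall x \near (0 : R), 2^-1 < bump x.
    by have := cb 0 => /cvgr_gt; apply; rewrite b0; lra.
  move=> /nbhs_ballP[e /= e0 He]; exists (e / 2); first lra.
  move=> x xe; apply/ltW/He; rewrite /ball/= sub0r normrN.
  by apply: (le_lt_trans xe); lra.
have dl1 : dl < 1.
  rewrite ltNge; apply/negP => dl1.
  have := Hdl 1; rewrite normr1 => /(_ dl1).
  rewrite bs ?normr1//; lra.
have [mw _ iw] := lw.
(* Since [davg] averages over a ball of length 2r, the factor 2 restores the integral of |w - w y|
   divided by r. *)
have key (r : R) : 0 < r -> ((`|w y| * dl)%:E <= 2%:E * davg w y r)%E.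
  move=> r0.
  pose B : set R := ball y r.
  pose br (x : R) := bump (r^-1 * (x - y)).
  have mB : measurable B by exact: measurable_ball.
  have muB : mu B = (r *+ 2)%:E by rewrite lebesgue_measure_ball// ltW.
  have muBy : (mu B < +oo)%E by rewrite muB ltry.
  have tr : test br.
    by apply: test_affine => //; rewrite invr_gt0.
  have outB x : ~ B x -> br x = 0.
    rewrite /br /B ball_itv/= in_itv/= -ltr_distl => /negP; rewrite -leNgt => h.
    by apply: bs; rewrite normrM gtr0_norm ?invr_gt0// mulrC ler_pdivlMr// mul1r.
  have mbr : measurable_fun (setT : set R) br.
    by apply: continuous_measurable_fun; apply: smooth_continuous; case: tr.
  have ib : mu.-integrable B (EFin \o br).
    apply: (@integrable_fin_bounded _ _ _ 1) => //; first exact: measurable_funTS.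
    by move=> x _; have /andP[? h] := b01 (r^-1 * (x - y)); rewrite ger0_norm.
  have iwB : mu.-integrable B (EFin \o w).
    apply: (@integrableS _ _ _ mu `[y - r, y + r]) => //.
      by rewrite /B ball_itv; apply: subset_itvW; rewrite bnd_simp.
    apply/integrableP; split; first by apply/measurable_EFinP; exact: measurable_funTS.
    by apply: iw => //; exact: segment_compact.
  have ic (k : R) : mu.-integrable B (EFin \o (cst k)).
    exact: integrable_cst_fin.
  have iwy : mu.-integrable B (EFin \o (fun x => w x - w y)).
    by apply: (integrable_sub mB iwB (ic (w y))).
  have le1 x : `|br x| <= 1.
    by have /andP[h ?] := b01 (r^-1 * (x - y)); rewrite ger0_norm.
  have iwb (u : R -> R) : mu.-integrable B (EFin \o u) ->
      mu.-integrable B (EFin \o (fun x : R => u x * br x)).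
    by move=> iu; apply: (@integrable_mul_bounded _ _ _ _ 1) => //; exact: measurable_funTS.
  have := wf _ tr; rewrite (@Rintegral_support _ B); last first.
    by move=> x /outB ->; rewrite mulr0.
  have -> : \int[mu]_(x in B) (w x * br x) =
      \int[mu]_(x in B) ((w x - w y) * br x + w y * br x).
    by apply: eq_Rintegral => x _; rewrite -mulrDl subrK.
  rewrite RintegralD//; [|exact: iwb|exact: (iwb (cst (w y)))].
  rewrite RintegralZl// => /eqP; rewrite addrC addr_eq0 => /eqP E.
  have low : dl * r <= \int[mu]_(x in B) br x.
    pose B' : set R := ball y (dl * r).
    have mB' : measurable B' by exact: measurable_ball.
    have muB' : mu B' = (dl * r *+ 2)%:E by rewrite lebesgue_measure_ball// mulr_ge0// ltW.
    have iB' : mu.-integrable B (EFin \o (\1_B' : R -> R)).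
      apply: (@integrable_fin_bounded _ _ _ 1) => //.
      by move=> x _; rewrite indicE ger0_norm// lern1 leq_b1.
    apply: (@le_trans _ _ (\int[mu]_(x in B) ((2^-1 : R) * \1_B' x))).
      rewrite RintegralZl// /Rintegral integral_indic// setIidl; last first.
        by apply: le_ball; rewrite ger_pMl// ltW.
      rewrite [X in fine X](_ : _ = (dl * r *+ 2)%:E); last exact: muB'.
      have half (q : R) : q <= 2^-1 * (q *+ 2) by rewrite -(mulr_natl q) mulrA mulVf// mul1r.
      exact: half.
    apply: le_Rintegral => //.
      exact: integrable_scale.
    move=> x _; rewrite indicE.
    case: (boolP (x \in _)); last by rewrite mulr0; have /andP[] := b01 (r^-1 * (x - y)).
    rewrite inE /B' ball_itv/= in_itv/= -ltr_distl mulr1 => xy; apply: Hdl.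
    by rewrite normrM gtr0_norm ?invr_gt0// mulrC ler_pdivrMr// ltW.
  have up : `|\int[mu]_(x in B) ((w x - w y) * br x)| <=
      \int[mu]_(x in B) `|w x - w y|.
    apply: (le_trans (le_normr_Rintegral _ _)) => //; first exact: iwb.
    apply: le_Rintegral => //.
    - exact: (integrable_norm (iwb _ iwy)).
    - exact: (integrable_norm iwy).
    - by move=> x _; rewrite normrM ler_piMr.
  have fin : (\int[mu]_(x in B) `|w x - w y|)%:E = (\int[mu]_(x in B) `|w x - w y|%:E)%E.
    by rewrite /Rintegral fineK//; apply: integrable_fin_num => //; exact: (integrable_norm iwy).
  rewrite /davg /iavg muB -fin inver mulrn_eq0/= gt_eqF// -!EFinM lee_fin.
  have cancel2 (q I : R) : q != 0 -> 2 * ((q *+ 2)^-1 * I) = q^-1 * I.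
    by move=> q0; rewrite -(mulr_natr q); field.
  rewrite cancel2 ?gt_eqF// ler_pdivlMl//.
  have wle : `|w y * \int[mu]_(x in B) br x| <= \int[mu]_(x in B) `|w x - w y|.
    by rewrite E normrN; exact: up.
  apply: le_trans wle; rewrite normrM mulrCA (mulrC r) ler_wpM2l//.
  exact: le_trans low (ler_norm _).
apply/eqP; rewrite -normr_eq0; apply: contraT => wy0.
(* At a Lebesgue point [davg] falls below this value, so [key] would bound the positive number |w y|
   dl by half of itself. *)
have e0 : 0 < `|w y| * dl / 4 by rewrite divr_gt0 ?mulr_gt0// lt_neqAle eq_sym wy0/=.
have nr : \forall r \near (0 : R)^'+, (davg w y r < (`|w y| * dl / 4)%:E)%E.
  exact: near_lt_cvg0e.
have : \forall r \near (0 : R)^'+, 0 < r /\ (davg w y r < (`|w y| * dl / 4)%:E)%E.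
  by apply: filterS2 (nbhs_right_gt _) nr => r; split.
move=> /filter_ex[r [r0 Hr]].
have := key r r0; move: Hr (davg_ge0 w y r); case: (davg w y r) => [s| |]//=.
rewrite lte_fin -EFinM !lee_fin => h1 _ h2; lra.
Qed.

End TestRescaling.

(** * Weak derivatives and bounds on the H^{-1} norm *)

Section NegativeSobolev.
Context {R : realType}.
Notation mu := (@lebesgue_measure R).
Implicit Types (f v w p q : R -> R).

Lemma L2_Lfun v : L2 v <-> v \in Lfun mu 2%:E.
Proof.
split=> [[mv nv]|]; first by rewrite inE; apply/andP; split; rewrite inE.
by rewrite inE => /andP[]; rewrite !inE.
Qed.

Lemma L2_mul_integrable p v : L2 p -> L2 v ->
  mu.-integrable setT (EFin \o (fun x => p x * v x)).
Proof.
move=> /L2_Lfun Lp /L2_Lfun Lv; apply/Lfun1_integrable.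
exact: (Lfun2_mul_Lfun1 Lp Lv).
Qed.

Lemma L2_sqr_integrable v : L2 v -> mu.-integrable setT (EFin \o (fun x => v x ^+ 2)).
Proof. by move=> /L2_Lfun/Lfun2_integrable_sqr. Qed.

Lemma L2norm_sqr_le v (c : R) : 0 <= c ->
  (\int[mu]_x ((v x ^+ 2)%:E) <= (c ^+ 2)%:E)%E -> (L2norm v <= c%:E)%E.
Proof.
move=> c0 vc; rewrite /L2norm unlock.
rewrite (@eq_integral _ _ _ mu setT (fun x => (v x ^+ 2)%:E)); last first.
  by move=> x _ /=; rewrite powR_mulrn// -normrX ger0_norm// sqr_ge0.
rewrite (_ : c%:E = ((c ^+ 2)%:E `^ 2^-1)%E).
  apply: gt0_ler_poweR => //; rewrite ?in_itv/= ?andbT ?leey ?lee_fin ?sqr_ge0//.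
  by rewrite andbT; apply: integral_ge0 => x _; rewrite lee_fin sqr_ge0.
by rewrite poweR_EFin -powR_mulrn// -powRrM mulfV ?pnatr_eq0// powRr1.
Qed.

Lemma L2_sqr v : measurable_fun setT v ->
  mu.-integrable setT (EFin \o (fun x => v x ^+ 2)) -> L2 v.
Proof.
move=> mv iv; split => //.
have vfin : (\int[mu]_x ((v x ^+ 2)%:E) \is a fin_num)%E by exact: integrable_fin_num iv.
have v0 : (0 <= \int[mu]_x ((v x ^+ 2)%:E))%E.
  by apply: integral_ge0 => x _; rewrite lee_fin sqr_ge0.
apply: (@le_lt_trans _ _ (Num.sqrt (fine (\int[mu]_x ((v x ^+ 2)%:E))))%:E); last exact: ltry.
apply: L2norm_sqr_le; first exact: sqrtr_ge0.
by rewrite sqr_sqrtr ?fine_ge0// fineK.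
Qed.

Lemma L2_lin (a : R) v w : L2 v -> L2 w -> L2 (fun x => a * v x + w x).
Proof.
move=> Lv Lw; have [[mv _] [mw _]] := (Lv, Lw).
have m : measurable_fun setT (fun x => a * v x + w x).
  by apply: measurable_funD => //; apply: measurable_funM.
apply: L2_sqr => //.
have iv := integrable_scale (2 * a ^+ 2) measurableT (L2_sqr_integrable Lv).
have iw := integrable_scale 2 measurableT (L2_sqr_integrable Lw).
apply: integrable_dominated (integrable_add measurableT iv iw) => //.
  exact: measurable_funX.
move=> x _; rewrite ger0_norm ?sqr_ge0//.
have := sqr_ge0 (a * v x - w x); nra.
Qed.

(** On a compact set |v| is dominated by 1 + v^2, and both terms are integrable there. *)
Lemma L2_locally_integrable v : L2 v -> locally_integrable setT v.
Proof.
move=> Lv; have [mv _] := Lv; split; [by []|exact: openT|].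
move=> K _ cK.
have mK : measurable K by exact: compact_measurable.
have i1 := integrable_cst_fin 1 mK (compact_finite_measure cK).
have i2 := @integrableS _ _ _ mu setT K _ measurableT mK (@subsetT _ _) (L2_sqr_integrable Lv).
have : mu.-integrable K (EFin \o v).
  apply: integrable_dominated (integrable_add mK i1 i2) => //; first exact: measurable_funTS.
  move=> x _; rewrite /cst /= -(@real_normK _ (v x)) ?num_real//.
  have := sqr_ge0 (`|v x| - 1); nra.
by case/integrableP.
Qed.

Lemma cauchy_schwarz p v (c : R) : L2 p -> L2 v -> (L2norm p <= c%:E)%E ->
  (`|\int[mu]_x (p x * v x)|%:E <= c%:E * L2norm v)%E.
Proof.
move=> Lp Lv pc; have ipv := L2_mul_integrable Lp Lv.
rewrite EFin_normr_Rintegral//.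
apply: (le_trans (le_abse_integral _ _ _)) => //; first by case/integrableP: ipv.
rewrite -Lnorm1.
apply: (le_trans (@hoelder _ _ _ mu p v 2 2 _ _ _ _ _)) => //.
- by case: Lp.
- by case: Lv.
- by rewrite [RHS]splitr !div1r.
- by apply: lee_wpmul2r => //; exact: Lnorm_ge0.
Qed.

Lemma C1c_L2 (a : R) f : 0 < a -> C1c a f -> L2 f /\ L2 (derive1 f).
Proof.
move=> a0 Cf; have [M M0 HM] := C1c_bounded a0 Cf; have [df cf fa] := Cf.
have L (h : R -> R) : continuous h -> (forall x, a < `|x| -> h x = 0) ->
    (forall x, `|h x| <= M) -> L2 h.
  move=> ch h0 hM.
  have mh := continuous_measurable_fun ch.
  apply: L2_sqr => //.
  have -> : (EFin \o (fun x => h x ^+ 2)) =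
      (EFin \o (fun x => h x ^+ 2)) \_ (`[- a, a]%classic).
    apply/funext => x; rewrite /patch; case: ifPn => // /negP.
    rewrite inE/= in_itv/= -ler_norml => /negP; rewrite -ltNge => /h0 /= ->.
    by rewrite expr0n.
  apply/integrable_restrict => //; rewrite setTI.
  apply: (@integrable_itv_bounded _ _ _ _ (M ^+ 2)).
    by apply: measurable_funTS; apply: measurable_funX.
  by move=> x _; rewrite normrX lerXn2r// nnegrE// ltW.
split; apply: L.
- exact: C1c_continuous Cf.
- by move=> x /ltW; exact: fa.
- by move=> x; case: (HM x).
- exact: cf.
- by move=> x; exact: C1c_derive1_out.
- by move=> x; case: (HM x).
Qed.

Lemma C1c_weak_derivative (a : R) f : 0 < a -> C1c a f ->
  weak_derivatives f (derive1 f).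
Proof.
move=> a0 Cf; split; first by case: (C1c_L2 a0 Cf).
by move=> h /test_C1c[b b0 Ch]; exact: (C1c_by_parts a0 b0).
Qed.

Lemma C1c_H1 (a : R) f : 0 < a -> C1c a f -> H1 f.
Proof.
move=> a0 Cf; split; first by case: (C1c_L2 a0 Cf).
by exists (derive1 f); exact: C1c_weak_derivative Cf.
Qed.

Lemma weak_derivativeP v : H1 v -> weak_derivatives v (weak_derivative v).
Proof. by move=> [_ /getPex]. Qed.

Lemma test_L2 f : test f -> L2 f /\ L2 (derive1 f).
Proof. by move=> /test_C1c[a a0]; exact: C1c_L2. Qed.

Lemma weak_derivatives_lin (a : R) v w v' w' : L2 v -> L2 w ->
  weak_derivatives v v' -> weak_derivatives w w' ->
  weak_derivatives (fun x => a * v x + w x) (fun x => a * v' x + w' x).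
Proof.
move=> Lv Lw [Lv' Hv] [Lw' Hw]; split; first exact: L2_lin.
move=> f tf; have [Lf Lf'] := test_L2 tf.
have lin (s t g : R -> R) : L2 s -> L2 t -> L2 g ->
    \int[mu]_x ((a * s x + t x) * g x) =
    a * \int[mu]_x (s x * g x) + \int[mu]_x (t x * g x).
  move=> Ls Lt Lg.
  rewrite -RintegralZl//; last exact: L2_mul_integrable.
  rewrite -RintegralD//; last 2 first.
  - exact: (integrable_scale a measurableT (L2_mul_integrable Ls Lg)).
  - exact: L2_mul_integrable.
  by apply: eq_Rintegral => x _; rewrite mulrDl mulrA.
by rewrite !lin// Hv// Hw// mulrN -opprD.
Qed.

Lemma H1_lin (a : R) v w : H1 v -> H1 w -> H1 (fun x => a * v x + w x).
Proof.
move=> Hv Hw; split; first by apply: L2_lin; [case: Hv|case: Hw].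
exists (fun x => a * weak_derivative v x + weak_derivative w x).
by apply: weak_derivatives_lin; [case: Hv|case: Hw|exact: weak_derivativeP..].
Qed.

(** What the du Bois-Reymond lemma asks of its bump. It stays a parameter here because the first
    cutoff will provide one. *)
Definition is_bump (b : R -> R) := [/\ test b, forall x, 0 <= b x <= 1, b 0 = 1
  & forall x, 1 <= `|x| -> b x = 0].

Variables (b : R -> R) (Hb : is_bump b).

(** The difference of two weak derivatives integrates to 0 against every test function. This is what
    allows [weak_derivative], an arbitrary choice, to be treated as linear and as an extension of
    [derive1], up to null sets. *)
Lemma weak_derivative_unique v w1 w2 :
  weak_derivatives v w1 -> weak_derivatives v w2 -> ae_eq mu setT w1 w2.
Proof.
move=> [L1 H1] [L2' H2]; case: Hb => tb b01 b0 bs.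
have Ld : L2 (fun x => -1 * w2 x + w1 x) by exact: L2_lin.
have : ae_eq mu setT (fun x => -1 * w2 x + w1 x) (cst 0).
  apply: (du_bois_reymond tb b01 b0 bs (L2_locally_integrable Ld)) => f tf.
  have [Lf _] := test_L2 tf.
  under eq_Rintegral do rewrite mulN1r addrC mulrBl.
  rewrite RintegralB//; [|exact: L2_mul_integrable..].
  by apply/eqP; rewrite subr_eq0 -eqr_opp -H1// -H2.
apply: filterS => x h _; have := h I; rewrite /cst mulN1r => /eqP.
by rewrite addrC subr_eq0 => /eqP.
Qed.

Lemma Rintegral_ae_eq p v w : L2 p -> L2 v -> L2 w -> ae_eq mu setT v w ->
  \int[mu]_x (p x * v x) = \int[mu]_x (p x * w x).
Proof.
move=> Lp Lv Lw vw; congr fine; apply: ae_eq_integral => //.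
- by case/integrableP: (L2_mul_integrable Lp Lv).
- by case/integrableP: (L2_mul_integrable Lp Lw).
- by apply: filterS vw => x h _; rewrite h.
Qed.

(** Replacing [derive1 f] by the weak derivative in the formula for [F] gives an extension to
    H^1(R). By Cauchy-Schwarz in each term it is bounded by c (|v| + |v'|) in L^2 norms, and this
    sum is exactly c times [H1norm v]. *)
Lemma Hminus1_of_L2 (F : (R -> R) -> R) p q (c : R) : 0 <= c -> L2 p -> L2 q ->
  (L2norm p <= c%:E)%E -> (L2norm q <= c%:E)%E ->
  (forall f, test f -> F f = - (\int[mu]_x (p x * f x) + \int[mu]_x (q x * derive1 f x))) ->
  Hminus1 F /\ (Hminus1_norm F <= c%:E)%E.
Proof.
move=> c0 Lp Lq pc qc FE.
pose G v := - (\int[mu]_x (p x * v x) + \int[mu]_x (q x * weak_derivative v x)).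
have GF : H1_extensions F G.
  split.
    move=> a v w Hv Hw; rewrite /G.
    have [Lv _] := Hv; have [Lw _] := Hw.
    have [Lv' _] := weak_derivativeP Hv; have [Lw' _] := weak_derivativeP Hw.
    (* The chosen weak derivative of the combination agrees only almost everywhere with the
       combination of the chosen ones, which suffices under the integral. *)
    rewrite (@Rintegral_ae_eq q (weak_derivative (fun x => a * v x + w x))
      (fun x => a * weak_derivative v x + weak_derivative w x))//; last 3 first.
    - by case: (weak_derivativeP (H1_lin a Hv Hw)).
    - exact: L2_lin.
    - apply: (@weak_derivative_unique (fun x => a * v x + w x)).
        exact/weak_derivativeP/H1_lin.
      by apply: weak_derivatives_lin => //; exact: weak_derivativeP.
    have lin (s g h : R -> R) : L2 s -> L2 g -> L2 h ->
        \int[mu]_x (s x * (a * g x + h x)) =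
        a * \int[mu]_x (s x * g x) + \int[mu]_x (s x * h x).
      move=> Ls Lg Lh.
      rewrite -RintegralZl//; last exact: L2_mul_integrable.
      rewrite -RintegralD//; last 2 first.
      - exact: (integrable_scale a measurableT (L2_mul_integrable Ls Lg)).
      - exact: L2_mul_integrable.
      by apply: eq_Rintegral => x _; rewrite mulrDr mulrCA.
    by rewrite !lin// addrACA -mulrDr opprD mulrN.
  move=> f tf; rewrite FE// /G; congr (- (_ + _)).
  have [a a0 Cf] := test_C1c tf.
  have Wf := C1c_weak_derivative a0 Cf; have Hf := C1c_H1 a0 Cf.
  apply: Rintegral_ae_eq => //.
  - by case: (weak_derivativeP Hf).
  - by case: Wf.
  - exact: (weak_derivative_unique (weak_derivativeP Hf) Wf).
have Gc : (operator_norm G <= c%:E)%E.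
  apply: ge_ereal_sup => _ [v [Hv nv] <-].
  have [Lv _] := Hv; have [Lv' _] := weak_derivativeP Hv.
  apply: (@le_trans _ _ (c%:E * H1norm v)%E); last first.
    by rewrite -[leRHS]mule1 lee_wpmul2l.
  rewrite /H1norm ge0_muleDr ?Lnorm_ge0// /G normrN.
  apply: (@le_trans _ _ (`|\int[mu]_x (p x * v x)|%:E +
    `|\int[mu]_x (q x * weak_derivative v x)|%:E)%E).
    by rewrite -EFinD lee_fin ler_normD.
  by apply: leeD; exact: cauchy_schwarz.
split; first by exists G => //; apply: le_lt_trans Gc (ltry _).
by apply: le_trans Gc; apply: ereal_inf_lbound; exists G.
Qed.

(** By the Leibniz rule (chi f)' psi = (chi' psi) f + (chi psi) f'. The two weights, extended by 0
    outside [-a, a], have L^2 norm at most M e. The bound [C] on [psi] serves integrability and does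
    not enter the estimate. *)
Lemma Hminus1_of_weight (F : (R -> R) -> R) (a C M e : R) (chi psi : R -> R) :
  0 < a -> 0 <= e -> C1c a chi -> (forall x, `|chi x| <= M /\ `|derive1 chi x| <= M) ->
  measurable_fun `[- a, a] psi -> (forall x, x \in `[- a, a] -> `|psi x| <= C) ->
  (\int[mu]_(x in `[(- a)%R, a]) (psi x ^+ 2)%:E <= (e ^+ 2)%:E)%E ->
  (forall f, test f -> F f =
    - \int[mu]_(x in `[- a, a]) (derive1 (fun y => chi y * f y) x * psi x)) ->
  Hminus1 F /\ (Hminus1_norm F <= (M * e)%:E)%E.
Proof.
move=> a0 e0 Cchi chiM mpsi psiC psie FE.
have M0 : 0 <= M by rewrite (le_trans _ (chiM 0).1).
have [dchi cchi chia] := Cchi.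
pose D : set R := `[- a, a]%classic.
have mD : measurable D by exact: measurable_itv.
have mchi : measurable_fun setT chi by apply: continuous_measurable_fun; exact: C1c_continuous Cchi.
have mchi' : measurable_fun setT (derive1 chi) by exact: continuous_measurable_fun.
pose wt (k : R -> R) : R -> R := (fun x : R => k x * psi x) \_ D.
have C0 : 0 <= C.
  by apply: le_trans (psiC 0 _); rewrite // in_itv/=; apply/andP; split; lra.
have mwt (k : R -> R) : measurable_fun setT k -> measurable_fun D (fun x : R => k x * psi x).
  by move=> mk; apply: measurable_funM => //; exact: measurable_funTS.
have bwt (k : R -> R) : (forall x, `|k x| <= M) -> forall x, x \in `[- a, a] -> `|k x * psi x| <= M * C.
  by move=> kM x xD; rewrite normrM ler_pM// psiC.
have wtP (k : R -> R) : measurable_fun setT k -> (forall x, `|k x| <= M) ->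
    L2 (wt k) /\ (L2norm (wt k) <= (M * e)%:E)%E.
  move=> mk kM.
  have E : (fun x : R => (wt k x ^+ 2)%:E) = ((fun x : R => ((k x * psi x) ^+ 2)%:E) \_ D)%E.
    by apply/funext => x; rewrite /wt /patch; case: ifP => //; rewrite expr0n.
  have i2 : mu.-integrable D (EFin \o (fun x : R => (k x * psi x) ^+ 2)).
    apply: (@integrable_itv_bounded _ _ _ _ ((M * C) ^+ 2)).
      by apply: measurable_funX; exact: mwt.
    by move=> x xD; rewrite normrX lerXn2r ?nnegrE ?mulr_ge0// bwt.
  split.
    apply: L2_sqr; first by exact: ((measurable_restrictT (fun x : R => k x * psi x) mD).1 (mwt _ mk)).
    rewrite (_ : EFin \o _ = (fun x : R => (wt k x ^+ 2)%:E))// E.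
    by apply/integrable_restrict => //; rewrite setTI.
  apply: L2norm_sqr_le; first exact: mulr_ge0.
  rewrite E -integral_mkcond exprMn EFinM.
  apply: (@le_trans _ _ ((M ^+ 2)%:E * \int[mu]_(x in D) (psi x ^+ 2)%:E)%E); last first.
    by rewrite lee_wpmul2l// lee_fin sqr_ge0.
  have mp2 : measurable_fun D (fun x : R => (psi x ^+ 2)%:E).
    by apply/measurable_EFinP; exact: measurable_funX.
  rewrite -ge0_integralZl_EFin//; [|by move=> x _; rewrite lee_fin sqr_ge0|exact: sqr_ge0].
  apply: ge0_le_integral => //.
  - by move=> x _; rewrite lee_fin sqr_ge0.
  - by apply/measurable_EFinP; apply: measurable_funX; exact: mwt.
  - by apply: measurable_funeM.
  - move=> x _; rewrite -EFinM lee_fin exprMn ler_wpM2r ?sqr_ge0//.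
    by rewrite -(@real_normK _ (k x)) ?num_real// lerXn2r ?nnegrE.
have [L1 N1] := wtP _ mchi' (fun x => (chiM x).2).
have [L2' N2] := wtP _ mchi (fun x => (chiM x).1).
apply: (@Hminus1_of_L2 F (wt (derive1 chi)) (wt chi)) => //; first exact: mulr_ge0.
move=> f tf; rewrite FE//; congr (- _).
have [sf _] := tf.
have wtE k (h : R -> R) : \int[mu]_x (wt k x * h x) = \int[mu]_(x in D) (k x * psi x * h x).
  rewrite (@Rintegral_support _ D); last first.
    by move=> x Dx; rewrite /wt patchN ?mul0r//; apply/negP; rewrite inE.
  by apply: eq_Rintegral => x xD; rewrite /wt patchT.
rewrite !wtE.
have [af af0 Cf] := test_C1c tf.
have [N N0 fN] := C1c_bounded af0 Cf.
have iw (k h : R -> R) : measurable_fun setT k -> (forall x, `|k x| <= M) ->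
    measurable_fun setT h -> (forall x, `|h x| <= N) ->
    mu.-integrable D (EFin \o (fun x : R => k x * psi x * h x)).
  move=> mk kM mh hN; apply: (@integrable_itv_bounded _ _ _ _ (M * C * N)).
    by apply: measurable_funM; [exact: mwt|exact: measurable_funTS].
  by move=> x xD; rewrite normrM ler_pM// bwt.
rewrite -RintegralD//; last 2 first.
- apply: iw => //; [by move=> x; case: (chiM x)| |by move=> x; case: (fN x)].
  exact: continuous_measurable_fun (smooth_continuous sf).
- apply: iw => //; [by move=> x; case: (chiM x)| |by move=> x; case: (fN x)].
  exact: continuous_measurable_fun (smooth_derive1_continuous sf).
apply: eq_Rintegral => x _; rewrite derive1M//; last exact: smooth_derivable.
by rewrite mulrDl mulrAC (mulrAC (chi x)).
Qed.

End NegativeSobolev.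

(** * The Hopf-Lax formula for |x| <= K and t <= T *)

Section HopfLaxBox.
Context {R : realType}.
Variables (u0 : R -> R) (K T Y M : R).
Implicit Types (s t x y : R).

Definition cost x t y := u0 y + t * g ((x - y) / t).

Lemma costE x t y : 0 < t -> cost x t y = u0 y + (x - y) ^+ 2 / (4 * t).
Proof. by move=> t0; rewrite /cost /g; congr (_ + _); field; rewrite gt_eqF. Qed.

Lemma cost_diag x t : cost x t x = u0 x.
Proof. by rewrite /cost /g subrr mul0r expr0n mul0r mulr0 addr0. Qed.

(** [Y] lies so far to the left that every competitor below it loses to the trivial competitor y =
    x, whose cost is [u0 x]. Minimizers are thereby confined to [Y, x], where [u0] has Lipschitz
    constant [M]. *)
Hypotheses (YK : Y <= - K) (M0 : 0 <= M) (cont : continuous u0)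
  (mono : {homo u0 : x y / x <= y})
  (lip : forall x y, Y <= x -> x <= y -> y <= K -> u0 y - u0 x <= M * (y - x))
  (coercive : forall x t y, `|x| <= K -> 0 < t -> t <= T -> y < Y -> u0 x < cost x t y).

Lemma cost_continuous x t : continuous (cost x t).
Proof.
move=> y; apply: cvgD; first exact: cont.
apply: cvgMr; rewrite /g; apply: cvgMl; apply: cvgM; apply: cvgMl; apply: cvgB => //;
  exact: cvg_cst.
Qed.

(** The extreme value theorem minimizes over [Y, x]; to the left of [Y] the cost exceeds [u0 x],
    which is itself a value on [Y, x]. *)
Lemma exists_minimizer x t : `|x| <= K -> 0 < t -> t <= T ->
  exists y, [/\ Y <= y, y <= x & forall y', y' <= x -> cost x t y <= cost x t y'].
Proof.
move=> xK t0 tT; have Yx : Y <= x by move: xK; rewrite ler_norml => /andP[]; move: YK; lra.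
have [y] := @EVT_min R (cost x t) _ _ Yx (continuous_subspaceT (cost_continuous (x := x) (t := t))).
rewrite in_itv/= => /andP[Yy yx] ymin; exists y; split => // y' y'x.
have [Yy'|y'Y] := leP Y y'; first by apply: ymin; rewrite in_itv/= Yy'.
apply: ltW; apply: le_lt_trans (coercive xK t0 tT y'Y).
by rewrite -[leRHS](cost_diag x t); apply: ymin; rewrite in_itv/= Yx lexx.
Qed.

Lemma hopf_lax_min x t y : 0 < t -> y <= x ->
  (forall y', y' <= x -> cost x t y <= cost x t y') -> hopf_lax u0 x t = cost x t y.
Proof.
move=> t0 yx ymin; rewrite /hopf_lax leNgt t0/=; apply/eqP; rewrite eq_le.
apply/andP; split.
  apply: ge_inf; last by exists y.
  by exists (cost x t y) => _ [z /= zx <-]; exact: ymin.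
by apply: lb_le_inf; [exists (cost x t y), y|move=> _ [z /= zx <-]; exact: ymin].
Qed.

Lemma minimizersP x t y : `|x| <= K -> 0 < t -> t <= T -> minimizers u0 x t y <->
  y <= x /\ forall y', y' <= x -> cost x t y <= cost x t y'.
Proof.
move=> xK t0 tT; rewrite /minimizers leNgt t0/=; split=> [[yx E]|[yx ymin]].
  split=> // y' y'x; have [z [_ zx zmin]] := exists_minimizer xK t0 tT.
  by rewrite [X in X <= _](_ : _ = cost x t z) ?zmin// -(hopf_lax_min t0 zx zmin) E.
by split=> //; exact: hopf_lax_min.
Qed.

Lemma hopf_lax_le x t y : `|x| <= K -> 0 < t -> t <= T -> y <= x ->
  hopf_lax u0 x t <= cost x t y.
Proof.
move=> xK t0 tT yx; have [z [_ zx zmin]] := exists_minimizer xK t0 tT.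
by rewrite (hopf_lax_min t0 zx zmin) zmin.
Qed.

Lemma hopf_lax0 x : hopf_lax u0 x 0 = u0 x.
Proof. by rewrite /hopf_lax lexx. Qed.

Lemma hopf_lax_le_u0 x t : `|x| <= K -> 0 <= t -> t <= T -> hopf_lax u0 x t <= u0 x.
Proof.
move=> xK; rewrite le_eqVlt => /predU1P[<- _|t0 tT]; first by rewrite hopf_lax0.
by rewrite -[leRHS](cost_diag x t) hopf_lax_le.
Qed.

Lemma minimizers_neq0 x t : `|x| <= K -> 0 <= t -> t <= T -> minimizers u0 x t !=set0.
Proof.
move=> xK; rewrite le_eqVlt => /predU1P[<- _|t0 tT].
  by exists x; rewrite /minimizers lexx.
have [z [_ zx zmin]] := exists_minimizer xK t0 tT.
by exists z; apply/minimizersP.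
Qed.

Lemma minimizers_itv x t y : `|x| <= K -> 0 <= t -> t <= T -> minimizers u0 x t y ->
  Y <= y <= x.
Proof.
move=> xK + tT; rewrite le_eqVlt => /predU1P[<-|t0].
  rewrite /minimizers lexx/= => ->; rewrite lexx andbT.
  by move: xK; rewrite ler_norml => /andP[]; move: YK; lra.
move=> /(minimizersP _ xK t0 tT)[yx ymin]; rewrite yx andbT leNgt; apply/negP => yY.
by have := ymin x (lexx x); rewrite leNgt cost_diag coercive.
Qed.

Lemma minimizers_value x t y : `|x| <= K -> 0 < t -> t <= T -> minimizers u0 x t y ->
  hopf_lax u0 x t = cost x t y.
Proof. by move=> xK t0 tT /(minimizersP _ xK t0 tT)[yx]; exact: hopf_lax_min. Qed.

(** Includes t = 0, where the only minimizer is [x] and the diagonal cost is [u0 x] whatever the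
    value of a division by 0. This is needed along sequences of times that may hit 0. *)
Lemma minimizers_cost x t y : `|x| <= K -> 0 <= t -> t <= T -> minimizers u0 x t y ->
  cost x t y - hopf_lax u0 x t = 0.
Proof.
move=> xK; rewrite le_eqVlt => /predU1P[<- _|t0 tT Iy].
  by rewrite /minimizers lexx/= => ->; rewrite cost_diag hopf_lax0 subrr.
by rewrite (minimizers_value xK t0 tT Iy) subrr.
Qed.

(** Comparison with the competitor x gives (x - y)^2 / (4t) <= u0 x - u0 y <= M (x - y); then divide
    by x - y. *)
Lemma minimizers_speed x t y : `|x| <= K -> 0 <= t -> t <= T -> minimizers u0 x t y ->
  x - y <= 4 * M * t.
Proof.
move=> xK t0' tT Ixy; have /andP[Yy yx] := minimizers_itv xK t0' tT Ixy.
move: t0'; rewrite le_eqVlt => /predU1P[t0|t0].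
  by move: Ixy; rewrite /minimizers -t0 lexx/= => ->; rewrite subrr mulr0.
have [_ ymin] := (minimizersP _ xK t0 tT).1 Ixy.
have := ymin x (lexx x); rewrite cost_diag costE//.
have xK' : x <= K by move: xK; rewrite ler_norml => /andP[].
have := lip Yy yx xK' => h1 h2.
have h3 : (x - y) ^+ 2 / (4 * t) <= M * (x - y) by lra.
move: h3; rewrite ler_pdivrMr ?mulr_gt0// => h3.
have [->|xy] := eqVneq x y; first by rewrite subrr !mulr_ge0// ltW.
have xy0 : 0 < x - y by rewrite subr_gt0 lt_neqAle eq_sym xy.
rewrite -(ler_pM2r xy0); nra.
Qed.

(** Upper bound: a minimizer for x, translated by x' - x, competes for x' at the same quadratic
    cost. Lower bound: a minimizer y' for x' is a cheaper competitor for x if y' <= x; otherwise u0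
    x <= u0 y' by monotonicity. *)
Lemma hopf_lax_space x x' t : - K <= x -> x <= x' -> x' <= K -> 0 <= t -> t <= T ->
  0 <= hopf_lax u0 x' t - hopf_lax u0 x t <= M * (x' - x).
Proof.
move=> Kx xx' x'K + tT.
have xK : `|x| <= K by rewrite ler_norml; apply/andP; split; lra.
have xK' : `|x'| <= K by rewrite ler_norml; apply/andP; split; lra.
rewrite le_eqVlt => /predU1P[<-|t0].
  rewrite !hopf_lax0 subr_ge0 mono//=; apply: lip => //; move: YK; lra.
have ne := minimizers_neq0.
have [y Iy] := ne x t xK (ltW t0) tT.
have [y' Iy'] := ne x' t xK' (ltW t0) tT.
have /andP[Yy yx] := minimizers_itv xK (ltW t0) tT Iy.
have /andP[Yy' yx'] := minimizers_itv xK' (ltW t0) tT Iy'.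
have v := minimizers_value xK t0 tT Iy; have v' := minimizers_value xK' t0 tT Iy'.
apply/andP; split; last first.
  have := @hopf_lax_le x' t (y + (x' - x)) xK' t0 tT.
  rewrite v !costE//.
  have -> : x' - (y + (x' - x)) = x - y by ring.
  have := @lip y (y + (x' - x)) Yy; rewrite lerDl subr_ge0 => /(_ xx').
  have -> : y + (x' - x) - y = x' - x by ring.
  move=> h1 h2; have := h1 _; have := h2 _; lra.
rewrite subr_ge0; have [y'x|xy'] := leP y' x.
  apply: (le_trans (hopf_lax_le xK t0 tT y'x)); rewrite v' !costE// lerD2l.
  rewrite ler_pM2r ?invr_gt0 ?mulr_gt0// lerXn2r ?nnegrE//; lra.
apply: (le_trans (hopf_lax_le_u0 xK (ltW t0) tT)); rewrite v' costE//.
apply: (le_trans (mono (ltW xy'))); rewrite lerDl divr_ge0 ?sqr_ge0// mulr_ge0// ltW//.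
Qed.

(** A minimizer for time s is a cheaper competitor at the later time t. Conversely, let y be a
    minimizer at time t and v = (x - y) / t the slope of its characteristic: the point x - s v = y +
    (t - s) v competes at time s with the same slope. Only the increment of [u0] over a length (t -
    s) v is lost, and v <= 4 M by [minimizers_speed]. *)
Lemma hopf_lax_time x s t : `|x| <= K -> 0 <= s -> s <= t -> t <= T ->
  0 <= hopf_lax u0 x s - hopf_lax u0 x t <= 4 * M ^+ 2 * (t - s).
Proof.
move=> xK s0 st tT; have sT := le_trans st tT; have t0 := le_trans s0 st.
have xK' : x <= K by move: xK; rewrite ler_norml => /andP[].
apply/andP; split.
  rewrite subr_ge0; move: s0; rewrite le_eqVlt => /predU1P[<-|s0].
    by rewrite hopf_lax0 hopf_lax_le_u0.
  have [y Iy] := minimizers_neq0 xK (ltW s0) sT.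
  have /andP[_ yx] := minimizers_itv xK (ltW s0) sT Iy.
  have t0' := lt_le_trans s0 st.
  rewrite (minimizers_value xK s0 sT Iy) (le_trans (hopf_lax_le xK t0' tT yx))//.
  rewrite !costE// lerD2l ler_wpM2l ?sqr_ge0// lef_pV2 ?posrE ?mulr_gt0//.
  by rewrite ler_pM2l.
move: t0; rewrite le_eqVlt => /predU1P[t0|t0].
  have -> : s = t by apply/eqP; rewrite eq_le st -t0.
  by rewrite !subrr mulr0.
have [y Iy] := minimizers_neq0 xK (ltW t0) tT.
have /andP[Yy yx] := minimizers_itv xK (ltW t0) tT Iy.
have sp := minimizers_speed xK (ltW t0) tT Iy.
pose v := (x - y) / t.
have vt : x - y = v * t by rewrite /v divfK ?gt_eqF.
have v0 : 0 <= v by rewrite divr_ge0 ?subr_ge0// ltW.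
have vM : v <= 4 * M by rewrite /v ler_pdivrMr.
have tv0 : 0 <= (t - s) * v by rewrite mulr_ge0// subr_ge0.
have sv0 : 0 <= s * v by rewrite mulr_ge0.
have l : u0 (x - s * v) - u0 y <= M * ((t - s) * v).
  have := @lip y (x - s * v) Yy; rewrite [x - s * v - y](_ : _ = (t - s) * v); last first.
    by rewrite addrAC vt; ring.
  by apply; lra.
have up : hopf_lax u0 x s <= u0 (x - s * v) + s * (v ^+ 2 / 4).
  move: s0; rewrite le_eqVlt => /predU1P[<-|s0]; first by rewrite hopf_lax0 !mul0r subr0 addr0.
  have := @hopf_lax_le x s (x - s * v) xK s0 sT.
  rewrite /cost /g (_ : (x - (x - s * v)) / s = v); last by field; rewrite gt_eqF.
  by apply; lra.
have vE : hopf_lax u0 x t = u0 y + t * (v ^+ 2 / 4) by rewrite (minimizers_value xK t0 tT Iy).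
rewrite vE.
have h1 : s * (v ^+ 2 / 4) <= t * (v ^+ 2 / 4).
  by rewrite ler_wpM2r// divr_ge0// sqr_ge0.
have h2 : M * ((t - s) * v) <= M * ((t - s) * (4 * M)).
  by rewrite ler_wpM2l// ler_wpM2l// subr_ge0.
have -> : 4 * M ^+ 2 * (t - s) = M * ((t - s) * (4 * M)) by ring.
lra.
Qed.

(** If y' < y, each point is an admissible competitor for the other problem. Adding the two
    minimality inequalities contradicts strict convexity: the sums of squares differ by 2 (x' - x)(y
    - y') > 0. *)
Lemma minimizers_mono x x' t y y' : `|x| <= K -> `|x'| <= K -> 0 <= t -> t <= T ->
  x < x' -> minimizers u0 x t y -> minimizers u0 x' t y' -> y <= y'.
Proof.
move=> xK xK' + tT xx'; rewrite le_eqVlt => /predU1P[<-|t0].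
  by rewrite /minimizers lexx/= => -> ->; exact: ltW.
move=> /(minimizersP _ xK t0 tT)[yx ymin] /(minimizersP _ xK' t0 tT)[yx' ymin'].
rewrite leNgt; apply/negP => y'y.
have := ymin y' (ltW (lt_le_trans y'y yx)).
have := ymin' y (le_trans yx (ltW xx')).
rewrite !costE// => h1 h2.
have : (x' - y') ^+ 2 / (4 * t) + (x - y) ^+ 2 / (4 * t) <=
  (x' - y) ^+ 2 / (4 * t) + (x - y') ^+ 2 / (4 * t) by lra.
rewrite -!mulrDl ler_pM2r ?invr_gt0 ?mulr_gt0//.
have : 0 < (x' - x) * (y - y') by rewrite mulr_gt0// subr_gt0.
nra.
Qed.

Lemma minimizers_closed x t : `|x| <= K -> 0 <= t -> t <= T -> closed (minimizers u0 x t).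
Proof.
move=> xK + tT; rewrite le_eqVlt => /predU1P[<-|t0].
  by rewrite /minimizers lexx; exact: (compact_closed (@Rhausdorff R) (@compact_set1 _ x)).
rewrite (_ : minimizers u0 x t = [set y | y <= x] `&`
    (cost x t) @^-1` [set z | z <= hopf_lax u0 x t]).
  apply: closedI; first exact: closed_le.
  by apply: closed_comp; [move=> y _; exact: cost_continuous|exact: closed_le].
apply/seteqP; split=> y.
  move=> Iy; split; last by rewrite /= (minimizers_value xK t0 tT Iy).
  by have /andP[] := minimizers_itv xK (ltW t0) tT Iy.
move=> [/= yx yu]; apply/minimizersP => //; split=> // y' y'x.
exact: (le_trans yu (hopf_lax_le xK t0 tT y'x)).
Qed.

Lemma minimizers_compact x t : `|x| <= K -> 0 <= t -> t <= T -> compact (minimizers u0 x t).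
Proof.
move=> xK t0 tT; apply: (@subclosed_compact _ _ `[Y, x]).
- exact: minimizers_closed.
- exact: segment_compact.
- by move=> y /(minimizers_itv xK t0 tT); rewrite /= in_itv.
Qed.

(** Joint continuity in time and position makes a nonzero gap an open condition, so that limits of
    minimizers are minimizers. *)
Lemma cost_gap_continuous x (p : R * R) : `|x| <= K -> 0 < p.1 -> p.1 < T ->
  {for p, continuous (fun q : R * R => cost x q.1 q.2 - hopf_lax u0 x q.1)}.
Proof.
move=> xK p0 pT; apply: cvgB.
  apply: cvgD.
    by apply: (continuous_comp (g := u0)); [exact: cvg_snd|exact: cont].
  apply: cvgM; first exact: cvg_fst.
  have h : (x - q.2) / q.1 @[q --> p] --> (x - p.2) / p.1.
    apply: cvgM; first by apply: cvgB; [exact: cvg_cst|exact: cvg_snd].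
    by apply: cvgV; [rewrite gt_eqF|exact: cvg_fst].
  by rewrite /g; apply: cvgMl; apply: cvgM.
apply: (continuous_comp (f := fst) (g := hopf_lax u0 x)); first exact: cvg_fst.
apply/cvgrPdist_le => /= e e0.
have c0 : 0 < 4 * M ^+ 2 + 1 by rewrite ltr_wpDl// mulr_ge0// sqr_ge0.
have d0 : 0 < e / (4 * M ^+ 2 + 1) by rewrite divr_gt0.
near=> s.
have s0 : 0 < s by near: s; exact: lt_nbhsr.
have sT : s < T by near: s; exact: lt_nbhsl.
have sp : `|p.1 - s| <= e / (4 * M ^+ 2 + 1).
  by near: s; apply: (@cvgr_dist_le _ R^o _ _ _ id p.1 cvg_id).
rewrite ler_pdivlMr// in sp; apply: le_trans sp.
have M20 := sqr_ge0 M.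
have [sp|ps] := leP s p.1.
  have /andP[h1 h2] := hopf_lax_time xK (ltW s0) sp (ltW pT).
  rewrite distrC ger0_norm// ger0_norm ?subr_ge0//; nra.
have /andP[h1 h2] := hopf_lax_time xK (ltW p0) (ltW ps) (ltW sT).
rewrite ger0_norm// distrC ger0_norm ?subr_ge0 ?(ltW ps)//.
move: ps; rewrite -subr_gt0; nra.
Unshelve. all: by end_near. Qed.

(** At t = 0 the speed bound squeezes the minimizers to x. For t > 0 they stay in a compact
    interval, and each cluster point has zero gap, hence is a minimizer at time t, hence is z; a
    sequence in a compact set with one cluster point converges. *)
Lemma minimizers_cvg x t z (s_ y_ : nat -> R) : `|x| <= K -> 0 <= t -> t < T ->
  minimizers u0 x t = [set z] -> s_ @ \oo --> t -> (forall n, 0 <= s_ n <= T) ->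
  (forall n, minimizers u0 x (s_ n) (y_ n)) -> y_ @ \oo --> z.
Proof.
move=> xK t0' tT Iz st s0T Iy.
have yI n : Y <= y_ n <= x.
  by have /andP[? ?] := s0T n; exact: (minimizers_itv xK _ _ (Iy n)).
move: t0'; rewrite le_eqVlt => /predU1P[t0|t0].
  have -> : z = x.
    by move/seteqP: Iz => [_ /(_ z erefl)]; rewrite /minimizers -t0 lexx.
  apply: (@squeeze_cvgr _ _ _ _ (fun n => x - 4 * M * s_ n) (cst x)).
  - apply: nearW => n; have /andP[? ?] := s0T n; have /andP[_ ->] := yI n.
    by have := minimizers_speed xK _ _ (Iy n); lra.
  - rewrite -[X in _ --> X]subr0; apply: cvgB; first exact: cvg_cst.
    by rewrite -(mulr0 (4 * M)) t0; apply: cvgMr.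
  - exact: cvg_cst.
have zI : Y <= z <= x.
  by apply: (minimizers_itv xK (ltW t0) (ltW tT)); rewrite Iz.
(* The margin 1 makes the compact interval a neighbourhood of [z], as [compact_cluster_set1]
   demands. *)
pose V := `[Y - 1, x + 1]%classic : set R.
have VF : \forall n \near \oo, V (y_ n).
  by apply: nearW => n; rewrite /V/= in_itv/=; have := yI n; lra.
have clz w : cluster (y_ @ \oo) w -> w = z.
  move=> cw.
  have wx : w <= x.
    have : closure [set y : R | y <= x] w.
      move=> A nA; apply: (cw [set y : R | y <= x] A) => //.
      have : \forall n \near \oo, y_ n <= x by apply: nearW => n; have /andP[] := yI n.
      exact.
    by rewrite -(closure_id _).1//; exact: closed_le.
  suff E : cost x t w - hopf_lax u0 x t = 0.
    suff : [set z] w by [].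
    rewrite -Iz; apply/minimizersP => //; first exact: ltW.
    split=> // y' y'x; move/eqP: E; rewrite subr_eq0 => /eqP ->.
    by apply: hopf_lax_le => //; exact: ltW.
  apply/eqP; apply: contraT => ne.
  have := @cost_gap_continuous x (t, w) xK t0 tT.
  move=> /cvgr_neq0/(_ ne) [[A1 A2] /= [nA1 nA2] HA].
  (* Building the condition on [s_ n] into the set of values lets the cluster property return one
     index that is good for both coordinates. *)
  have nA : \forall n \near \oo, [set y_ n | n in [set n | A1 (s_ n)]] (y_ n).
    have h0 : \forall n \near \oo, A1 (s_ n) := st _ nA1.
    by apply: filterS h0 => n h; exists n.
  have [w' [[n A1n <-] A2n]] := cw [set y_ n | n in [set n | A1 (s_ n)]] A2 nA nA2.
  have /andP[sn0 snT] := s0T n.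
  have := HA (s_ n, y_ n) (conj A1n A2n).
  by rewrite /= (minimizers_cost xK sn0 snT (Iy n)) eqxx.
apply: (compact_cluster_set1 (V := V)) => //.
- exact: segment_compact.
- have zV : z \in `]Y - 1, x + 1[ by rewrite in_itv/=; lra.
  by apply: filterS (near_in_itvoo zV) => v /subset_itv_oo_cc.
- apply/seteqP; split=> [w /clz //|_ ->].
  have [w [_ cw]] := @segment_compact R (Y - 1) (x + 1) (y_ @ \oo) _ VF.
  by rewrite -(clz _ cw).
Qed.

End HopfLaxBox.

(** * Minima over the sets of minimizers, and shocks *)

Section HopfLaxGlobal.
Context {R : realType}.
Notation mu := (@lebesgue_measure R).
Variable u0 : R -> R.
Implicit Types (s t x y K T : R).

Definition hopf_lax_box K T Y M := [/\ Y <= - K, 0 <= M,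
  forall x y, Y <= x -> x <= y -> y <= K -> u0 y - u0 x <= M * (y - x) &
  forall x t y, `|x| <= K -> 0 < t -> t <= T -> y < Y -> u0 x < cost u0 x t y].

Hypotheses (cont : continuous u0) (mono : {homo u0 : x y / x <= y})
  (boxes : forall K T, 0 < K -> 0 < T -> exists Y M, hopf_lax_box K T Y M).

Lemma hopf_lax_lipschitz K T : 0 < K -> 0 < T -> exists2 L : R, 0 <= L &
  (forall x x' t, `|x| <= K -> `|x'| <= K -> 0 <= t -> t <= T ->
     `|hopf_lax u0 x t - hopf_lax u0 x' t| <= L * `|x - x'|) /\
  (forall x s t, `|x| <= K -> 0 <= s -> s <= T -> 0 <= t -> t <= T ->
     `|hopf_lax u0 x s - hopf_lax u0 x t| <= L * `|s - t|).
Proof.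
move=> K0 T0; have [Y [M [YK M0 lip coer]]] := boxes K0 T0.
exists (M + 4 * M ^+ 2); first by rewrite addr_ge0// mulr_ge0// sqr_ge0.
have M2 : 0 <= 4 * M ^+ 2 by rewrite mulr_ge0// sqr_ge0.
split.
  move=> x x' t xK x'K t0 tT.
  wlog xx' : x x' xK x'K / x <= x'.
    have [xx'|/ltW xx'] := leP x x'; first exact.
    by rewrite distrC [`|x - _|]distrC; apply.
  have /andP[h1 h2] := hopf_lax_space YK cont mono lip coer
    (lerNnormlW xK) xx' (ler_normlW x'K) t0 tT.
  rewrite distrC ger0_norm// distrC ger0_norm ?subr_ge0// (le_trans h2)//.
  by rewrite ler_wpM2r ?subr_ge0// lerDl.
move=> x s t xK s0 sT t0 tT.
wlog st : s t s0 sT t0 tT / s <= t.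
  have [st|/ltW st] := leP s t; first exact.
  by rewrite distrC [`|s - _|]distrC; apply.
have /andP[h1 h2] := hopf_lax_time YK M0 cont lip coer xK s0 st tT.
rewrite ger0_norm// distrC ger0_norm ?subr_ge0// (le_trans h2)//.
by rewrite ler_wpM2r ?subr_ge0// lerDr.
Qed.

Variable b : R -> R.
Hypothesis bcont : continuous b.

(** This is [zeta] at a fixed sample when [b y] is the Brownian path at the integral of [rho0 ^+ 2]
    from 0 to y. *)
Definition min_value x t := inf [set b y | y in minimizers u0 x t].

Lemma min_valueP x t : 0 <= t -> exists2 y, minimizers u0 x t y & min_value x t = b y.
Proof.
move=> t0; have K0 : 0 < `|x| + 1 by rewrite ltr_wpDl.
have T0 : 0 < t + 1 by rewrite ltr_wpDl.
have [Y [M [YK M0 lip coer]]] := boxes K0 T0.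
have xK : `|x| <= `|x| + 1 by rewrite lerDl.
have tT : t <= t + 1 by rewrite lerDl.
have [y Iy ymin] := compact_EVT_min
  (minimizers_neq0 YK cont coer xK t0 tT)
  (minimizers_compact YK cont coer xK t0 tT)
  (continuous_subspaceT bcont).
rewrite inE in Iy.
exists y => //; apply/eqP; rewrite eq_le; apply/andP; split.
  apply: ge_inf; last by exists y.
  by exists (b y) => _ [z /= Iz <-]; apply: ymin; rewrite inE.
by apply: lb_le_inf; [exists (b y), y|move=> _ [z /= Iz <-]; apply: ymin; rewrite inE].
Qed.

Lemma minimizers_nondecreasing x x' t y y' : 0 <= t -> x < x' ->
  minimizers u0 x t y -> minimizers u0 x' t y' -> y <= y'.
Proof.
move=> t0; have K0 : 0 < `|x| + `|x'| + 1 by rewrite ltr_wpDl// addr_ge0.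
have T0 : 0 < t + 1 by rewrite ltr_wpDl.
have [Y [M [YK M0 lip coer]]] := boxes K0 T0.
have x0 := normr_ge0 x; have x'0 := normr_ge0 x'.
by apply: (minimizers_mono YK cont coer) => //; lra.
Qed.

(** An optimal minimizer chosen for each x is a nondecreasing function of x, hence measurable,
    however the choice is made; [min_value] is the continuous [b] composed with it. *)
Lemma measurable_min_value t : 0 <= t -> measurable_fun setT (fun x => min_value x t).
Proof.
move=> t0.
pose sel x := sval (cid2 (min_valueP x t0)).
have selI x : minimizers u0 x t (sel x) by rewrite /sel; case: cid2.
have selE x : min_value x t = b (sel x) by rewrite /sel; case: cid2.
rewrite (_ : (fun x => _) = b \o sel); last by apply/funext => x; rewrite /= selE.
apply: measurableT_comp; first exact: continuous_measurable_fun.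
apply: nondecreasing_measurable => // x x'; rewrite le_eqVlt => /predU1P[->//|xx'].
exact: (minimizers_nondecreasing t0 xx').
Qed.

Lemma min_value_bounded K T : 0 < K -> 0 < T -> exists2 C : R, 0 <= C &
  forall x t, `|x| <= K -> 0 <= t -> t <= T -> `|min_value x t| <= C.
Proof.
move=> K0 T0; have [Y [M [YK M0 lip coer]]] := boxes K0 T0.
have YK' : Y <= K by move: YK; lra.
have cb : {within `[Y, K], continuous (fun y => `|b y|)}.
  apply: continuous_subspaceT => y; apply: continuous_comp; first exact: bcont.
  exact: norm_continuous.
have [c _ cmax] := EVT_max YK' cb.
exists `|b c| => // x t xK t0 tT.
have [y Iy ->] := min_valueP x t0; apply: cmax.
have /andP[Yy yx] := minimizers_itv YK cont coer xK t0 tT Iy.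
by rewrite in_itv/= Yy (le_trans yx)// ler_normlW.
Qed.

Definition shocks t := [set x | exists y y', [/\ minimizers u0 x t y,
  minimizers u0 x t y' & y < y']].

(* The open intervals spanned by the minimizers at distinct shocks are
   disjoint, so a rational in each of them determines the shock. *)
Lemma countable_shocks t : 0 <= t -> countable (shocks t).
Proof.
move=> t0.
have H x : exists q : rat, shocks t x -> exists y y', [/\ minimizers u0 x t y,
    minimizers u0 x t y', y < ratr q & ratr q < y'].
  have [[y [y' [Iy Iy' yy']]]|nx] := pselect (shocks t x); last by exists 0.
  by have [q] := rat_in_itvoo yy'; rewrite in_itv/= => /andP[? ?]; exists q => _; exists y, y'.
pose q x := sval (cid (H x)).
have qP x : shocks t x -> exists y y', [/\ minimizers u0 x t y,
    minimizers u0 x t y', y < ratr (q x) & ratr (q x) < y'] by rewrite /q; case: cid.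
apply: (@card_le_trans _ _ _ [set: rat]); last exact: countableP.
apply/pcard_injP; exists q => x x'; rewrite !inE => sx sx' qq.
apply/eqP; rewrite eq_le !leNgt; apply/andP; split; apply/negP => xx'.
  have [y [_ [Iy _ yq _]]] := qP _ sx; have [_ [y' [_ Iy' _ qy']]] := qP _ sx'.
  have := minimizers_nondecreasing t0 xx' Iy' Iy; rewrite leNgt => /negP; apply.
  by rewrite (lt_trans yq)// qq.
have [y [_ [Iy _ yq _]]] := qP _ sx'; have [_ [y' [_ Iy' _ qy']]] := qP _ sx.
have := minimizers_nondecreasing t0 xx' Iy' Iy; rewrite leNgt => /negP; apply.
by rewrite (lt_trans yq)// -qq.
Qed.

(** Off the shocks the minimizer is unique, optimal minimizers at the times [s_ n] converge to it,
    and [b] is continuous. *)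
Lemma min_value_cvg x t (s_ : nat -> R) : 0 <= t -> ~ shocks t x ->
  (forall n, 0 <= s_ n) -> s_ @ \oo --> t -> (min_value x (s_ n)) @[n --> \oo] --> min_value x t.
Proof.
move=> t0 nsh s0 st.
have [z Iz zE] := min_valueP x t0.
have Iz1 : minimizers u0 x t = [set z].
  apply/seteqP; split=> [y Iy|_ ->//].
  apply/eqP; rewrite eq_le !leNgt; apply/andP; split; apply/negP => yz; apply: nsh.
    by exists z, y.
  by exists y, z.
have [N _ HN] : \forall n \near \oo, s_ n < t + 1.
  by apply: (cvgr_lt t) => //; rewrite ltrDl.
have K0 : 0 < `|x| + 1 by rewrite ltr_wpDl.
have T0 : 0 < t + 1 by rewrite ltr_wpDl.
have [Y [M [YK M0 lip coer]]] := boxes K0 T0.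
have xK : `|x| <= `|x| + 1 by rewrite lerDl.
have tT : t < t + 1 by rewrite ltrDl.
pose sel n := sval (cid2 (min_valueP x (s0 n))).
have selI n : minimizers u0 x (s_ n) (sel n) by rewrite /sel; case: cid2.
have selE n : min_value x (s_ n) = b (sel n) by rewrite /sel; case: cid2.
rewrite zE; under eq_fun do rewrite selE.
apply: (@cvg_comp _ _ _ sel b _ (nbhs z)); last exact: bcont.
(* After the shift all times lie below t + 1, the height of the box. *)
rewrite -(cvg_shiftn N).
apply: (minimizers_cvg YK M0 cont lip coer (s_ := fun n => s_ (n + N)%N) (t := t) xK t0 tT Iz1).
- by rewrite cvg_shiftn.
- by move=> n; rewrite s0/= ltW// HN//= leq_addl.
- by move=> n; exact: selI.
Qed.

End HopfLaxGlobal.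

(** * Regularity and coercivity of [u0] from the assumptions on [rho0] *)

Section IntegralOfRate.
Context {R : realType}.
Notation mu := (@lebesgue_measure R).
Implicit Types (f : R -> R) (a x y : R).

Definition locally_bounded f := measurable_fun setT f /\
  forall K : R, exists C : R, forall x, `|x| <= K -> `|f x| <= C.

Lemma locally_bounded_integrable f a b : locally_bounded f ->
  mu.-integrable `[a, b] (EFin \o f).
Proof.
move=> [mf fb]; have [C HC] := fb (`|a| + `|b|).
apply: (@integrable_itv_bounded _ _ _ _ C); first exact: measurable_funTS.
move=> x; rewrite in_itv/= => /andP[ax xb]; apply: HC; rewrite ler_norml.
by move: (ler_norm a) (ler_norm (- a)) (ler_norm b) (ler_norm (- b)); rewrite !normrN; lra.
Qed.

Lemma Rintegral_itv_diff f a x y : locally_bounded f -> a <= x -> x <= y ->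
  \int[mu]_(s in `[a, y]) f s - \int[mu]_(s in `[a, x]) f s = \int[mu]_(s in `[x, y]) f s.
Proof.
move=> lf ax xy; rewrite Rintegral_itvB ?bnd_simp//; last exact: locally_bounded_integrable.
rewrite Rintegral_itv_obnd_cbnd//.
by apply: integrableS (locally_bounded_integrable x y lf) => //; exact: subset_itv_oc_cc.
Qed.

Lemma Rintegral_itv_le f x y (M : R) : locally_bounded f -> x <= y ->
  (forall s, x <= s -> s <= y -> f s <= M) -> \int[mu]_(s in `[x, y]) f s <= M * (y - x).
Proof.
move=> lf xy fM.
have -> : M * (y - x) = \int[mu]_(s in `[x, y]) cst M s.
  rewrite Rintegral_cst//= lebesgue_measure_itv/= lte_fin; case: ltP => //= yx.
  by have -> : x = y; [apply/eqP; rewrite eq_le xy|rewrite subrr].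
apply: le_Rintegral => //.
- exact: locally_bounded_integrable.
- by apply: integrable_cst_fin => //; exact: itv_finite_measure.
- by move=> s /=; rewrite in_itv/= => /andP[? ?]; exact: fM.
Qed.

Lemma Rintegral_itv_norm_le f x y (M : R) : locally_bounded f -> x <= y ->
  (forall s, x <= s -> s <= y -> `|f s| <= M) ->
  `|\int[mu]_(s in `[x, y]) f s| <= M * (y - x).
Proof.
move=> lf xy fM; rewrite (le_trans (le_normr_Rintegral _ _))//.
  exact: locally_bounded_integrable.
apply: Rintegral_itv_le => //; split; first by apply: measurableT_comp => //; case: lf.
by move=> K; have [C HC] := lf.2 K; exists C => s /HC; rewrite normr_id.
Qed.

Lemma Rintegral_itv_ge0 f x y : (forall s, 0 <= f s) -> 0 <= \int[mu]_(s in `[x, y]) f s.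
Proof. by move=> f0; exact: Rintegral_ge0. Qed.

Lemma local_lipschitz_continuous f : (forall K : R, exists2 M : R, 0 <= M & forall x y,
  - K <= x -> x <= y -> y <= K -> `|f y - f x| <= M * (y - x)) -> continuous f.
Proof.
move=> fl x; have [M M0 HM] := fl (`|x| + 1).
apply/cvgrPdist_le => /= e e0.
have d0 : 0 < e / (M + 1) by rewrite divr_gt0// ltr_wpDl.
near=> y.
have xy1 : `|x - y| <= 1 by near: y; apply: (@cvgr_dist_le _ R^o _ _ _ id x cvg_id).
have xyd : `|x - y| <= e / (M + 1) by near: y; apply: (@cvgr_dist_le _ R^o _ _ _ id x cvg_id).
move: xyd; rewrite ler_pdivlMr ?ltr_wpDl// => xyd; apply: le_trans xyd.
move: (ler_norm x) (ler_norm (- x)); rewrite normrN => h1 h2.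
move: xy1; rewrite ler_norml => /andP[h3 h4].
have [xy|yx] := leP x y.
  rewrite distrC (le_trans (HM x y _ _ _))//; [lra|lra|].
  by rewrite ler0_norm; [rewrite opprB|]; nra.
rewrite (le_trans (HM y x _ (ltW yx) _))//; [lra|lra|].
by rewrite ger0_norm; nra.
Unshelve. all: by end_near. Qed.

Lemma signed_integral_continuous f : locally_bounded f -> continuous (signed_integral f 0).
Proof.
move=> lf; apply: local_lipschitz_continuous => K.
have [M HM] := lf.2 (`|K|).
have K0 := ler_norm K.
exists `|M| => // x y Kx xy yK.
(* Integrating from a fixed left end removes the case distinction on signs. *)
have E s : - `|K| <= s -> signed_integral f 0 s =
    \int[mu]_(r in `[- `|K|, s]) f r - \int[mu]_(r in `[- `|K|, 0]) f r.
  move=> Ks; rewrite /signed_integral; case: leP => s0.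
    by rewrite Rintegral_itv_diff// oppr_le0.
  by rewrite -(Rintegral_itv_diff lf Ks (ltW s0)) opprB.
have Kx' : - `|K| <= x by lra.
have Ky' : - `|K| <= y by lra.
rewrite (E x Kx') (E y Ky').
rewrite opprB addrA subrK Rintegral_itv_diff//.
apply: Rintegral_itv_norm_le => // s xs sy.
by apply: le_trans (ler_norm M); apply: HM; rewrite ler_norml; lra.
Qed.

Variables (rho0 u0 : R -> R).
Hypotheses (rho0_ge0 : forall x, 0 <= rho0 x)
  (rho0_loc_bounded : forall K : set R, compact K -> [bounded rho0 x | x in K])
  (rho0_measurable : measurable_fun setT rho0)
  (rho0_growth : exists b : R,
     `|r|^-1 * sup [set rho0 x | x in `[r, b]] @[r --> -oo] --> (0 : R))
  (u0_rho0 : forall x y, y < x ->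
     u0 x - u0 y = \int[mu]_(r in `[y, x]) rho0 r).

Lemma rho0_locally_bounded : locally_bounded rho0.
Proof.
split=> // K; have [M [_ HM]] := rho0_loc_bounded (@segment_compact R (- K) K).
exists (M + 1) => x xK; apply: HM; first by rewrite ltrDl.
by rewrite /= in_itv/= -ler_norml.
Qed.

Lemma rho0_sqr_locally_bounded : locally_bounded (fun x => rho0 x ^+ 2).
Proof.
split; first exact: measurable_funX.
move=> K; have [C HC] := rho0_locally_bounded.2 K; exists (C ^+ 2) => x xK.
by rewrite normrX lerXn2r ?nnegrE ?HC// (le_trans _ (HC x xK)).
Qed.

Lemma u0_integral x y : y <= x -> u0 x - u0 y = \int[mu]_(r in `[y, x]) rho0 r.
Proof.
rewrite le_eqVlt => /predU1P[->|]; last exact: u0_rho0.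
by rewrite subrr set_itv1 Rintegral_set1.
Qed.

Lemma u0_nondecreasing : {homo u0 : x y / x <= y}.
Proof. by move=> x y xy; rewrite -subr_ge0 u0_integral// Rintegral_itv_ge0. Qed.

Lemma u0_lipschitz_on (M : R) x y : x <= y ->
  (forall s, x <= s -> s <= y -> rho0 s <= M) -> u0 y - u0 x <= M * (y - x).
Proof.
move=> xy rM; rewrite u0_integral//; apply: Rintegral_itv_le => //.
exact: rho0_locally_bounded.
Qed.

Lemma u0_continuous : continuous u0.
Proof.
apply: local_lipschitz_continuous => K.
have [M HM] := rho0_locally_bounded.2 K; exists `|M| => // x y Kx xy yK.
rewrite ger0_norm ?subr_ge0 ?u0_nondecreasing//; apply: u0_lipschitz_on => // s xs sy.
apply: le_trans (ler_norm M); apply: le_trans (ler_norm _) _; apply: HM; rewrite ler_norml; lra.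
Qed.

(** The growth condition is available for one [b] only. Between [b] and [K] a local bound on [rho0]
    takes over, and it is beaten by e |y| for y far to the left. *)
Lemma rho0_sublinear (K e : R) : 0 < e -> exists2 Y : R, Y < 0 &
  forall y s, y < Y -> y <= s -> s <= K -> rho0 s <= e * `|y|.
Proof.
move=> e0; have [b /cvgr_lt/(_ e e0) [N [_ HN]]] := rho0_growth.
have [M HM] := rho0_locally_bounded.2 (`|b| + `|K|).
(* Below [N] the growth condition gives the bound on [y, b]; below the second term |M| <= e |y|, and
   y is negative. *)
exists (Num.min N (- 1 - `|M| / e)).
  have Me0 : 0 <= `|M| / e by rewrite divr_ge0// ltW.
  by rewrite gt_min; apply/orP; right; lra.
move=> y s; rewrite lt_min => /andP[yN yM] ys sK.
have Me0 : 0 <= `|M| / e by rewrite divr_ge0// ltW.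
have y0 : y < 0 by lra.
have ny : 0 < `|y| by rewrite normr_gt0; lra.
have [sb|bs] := leP s b.
  have := HN _ yN; rewrite mulrC ltr_pdivrMr// => /ltW; apply: le_trans.
  apply: sup_upper_bound; last by exists s => //=; rewrite in_itv/= ys.
  split; first by exists (rho0 s), s => //=; rewrite in_itv/= ys.
  have [C HC] := rho0_locally_bounded.2 (`|y| + `|b|).
  exists C; move=> v [r /= + <-]; rewrite in_itv/= => /andP[yr rb].
  apply: (le_trans (ler_norm _)); apply: HC; rewrite ler_norml.
  by move: (ler_norm y) (ler_norm (- y)) (ler_norm b) (ler_norm (- b)); rewrite !normrN; lra.
apply: (@le_trans _ _ `|M|).
  apply: (le_trans (ler_norm _)); apply: (le_trans _ (ler_norm M)); apply: HM; rewrite ler_norml.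
  by move: (ler_norm K) (ler_norm (- K)) (ler_norm b) (ler_norm (- b)); rewrite !normrN; lra.
by rewrite -ler_pdivrMl// mulrC (ltr0_norm y0); lra.
Qed.

(** For y < Y the rate on [y, x] is at most |y| / (16 T), so u0 x - u0 y stays below (x - y)^2 /
    (4t) once (|y| / 4)(t / T) < x - y. As y < -2K and x >= -K, the right side exceeds |y| / 2. *)
Lemma u0_boxes (K T : R) : 0 < K -> 0 < T -> exists Y M, hopf_lax_box u0 K T Y M.
Proof.
move=> K0 T0.
have e0 : 0 < (16 * T)^-1 by rewrite invr_gt0 mulr_gt0.
have [Y1 Y10 HY] := rho0_sublinear K e0.
pose Y := Num.min Y1 (- (2 * K)).
have YY1 : Y <= Y1 by rewrite ge_min lexx.
have YK : Y <= - (2 * K) by rewrite ge_min lexx orbT.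
have [M HM] := rho0_locally_bounded.2 (`|Y|).
have nY : `|Y| = - Y by rewrite ler0_norm//; lra.
exists Y, `|M|; split => //.
- lra.
- move=> x y Yx xy yK; apply: u0_lipschitz_on => // s xs sy.
  apply: le_trans (ler_norm M); apply: le_trans (ler_norm _) _; apply: HM.
  rewrite ler_norml nY; lra.
move=> x t y xK t0 tT yY.
have /andP[xK1 xK2] : - K <= x <= K by rewrite -ler_norml.
have yx : y <= x by lra.
rewrite costE//.
have := @u0_lipschitz_on ((16 * T)^-1 * `|y|) y x yx.
have h : forall s, y <= s -> s <= x -> rho0 s <= (16 * T)^-1 * `|y|.
  by move=> s ys sx; apply: HY => //; lra.
move=> /(_ h) {h}; rewrite ltr0_norm; last lra.
move=> h; rewrite -ltrBlDl; apply: (le_lt_trans h).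
rewrite ltr_pdivlMr ?mulr_gt0//.
have -> : (16 * T)^-1 * - y * (x - y) * (4 * t) = (- y / 4) * (t / T) * (x - y).
  by field; rewrite gt_eqF.
rewrite expr2 ltr_pM2r; last lra.
apply: (@le_lt_trans _ _ (- y / 4)); last lra.
rewrite ler_piMr; [by []|lra|].
by rewrite ler_pdivrMr// mul1r.
Qed.

End IntegralOfRate.

(** * Almost sure continuity of two-sided Brownian motion *)

Section BrownianContinuity.
Context {R : realType}.

Lemma continuous_clamp (W : R -> R) : {within `[0, +oo[, continuous W} ->
  continuous (fun s : R => W (Num.max s 0)).
Proof.
move=> /subspace_continuousP cW s.
have A0 (r : R) : `[0, +oo[%classic (Num.max r 0) by rewrite /= in_itv/= andbT le_max lexx orbT.
have cm : continuous (fun r : R => Num.max r 0).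
  by move=> r; apply: continuous_max; [exact: cvg_id|exact: cvg_cst].
move=> U /(cW _ (A0 s)) WU.
have WU' : nbhs (Num.max s 0) [set x | `[0, +oo[%classic x -> U (W x)] := WU.
have h : \forall r \near s, `[0, +oo[%classic (Num.max r 0) -> U (W (Num.max r 0)) := cm s _ WU'.
by apply: filterS h => r; apply; exact: A0.
Qed.

(** Since both halves vanish at 0, clamping their arguments at 0 glues them into one formula valid
    on the whole line. *)
Lemma two_sided_continuous (B B1 B2 : R -> R) :
  {within `[0, +oo[, continuous B1} -> {within `[0, +oo[, continuous B2} ->
  B1 0 = 0 -> B2 0 = 0 -> (forall s, 0 <= s -> B s = B1 s) ->
  (forall s, s < 0 -> B s = - B2 (- s)) -> continuous B.
Proof.
move=> c1 c2 B10 B20 Bp Bn.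
have -> : B = fun s : R => B1 (Num.max s 0) - B2 (Num.max (- s) 0).
  apply/funext => s; have [s0|s0] := leP 0 s.
    by rewrite Bp// max_r ?oppr_le0// B20 subr0.
  by rewrite Bn// max_l ?oppr_ge0 ?(ltW s0)// B10 sub0r.
move=> s; apply: cvgB; first exact: continuous_clamp.
apply: (continuous_comp (f := -%R) (g := fun s : R => B2 (Num.max s 0))); first exact: opp_continuous.
exact: continuous_clamp.
Qed.

Lemma ae_two_sided_brownian_continuous (d : measure_display) (Omega : measurableType d)
    (P : probability Omega R) (B : R -> Omega -> R) : two_sided_brownian P B ->
  {ae P, forall w, continuous (fun s => B s w)}.
Proof.
move=> [B1 [B2 [[_ B10 _ _ c1] [_ B20 _ _ c2] _ BE]]].
apply: filterS3 (filterI B10 B20) c1 c2 => w [h1 h2] h3 h4.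
exact: (two_sided_continuous h3 h4 h1 h2 (BE w).1 (BE w).2).
Qed.

End BrownianContinuity.

(** * Lattice sums as distributional derivatives of step functions *)

Section StepFunctionals.
Context {R : realType}.
Notation mu := (@lebesgue_measure R).
Implicit Types (f psi : R -> R) (F : (R -> R) -> R) (n : nat) (c : int -> R).

(** The distributional derivative of [psi], but required on C^1 functions, so that it applies to
    [chi * f] directly. *)
Definition derivative_of F psi := forall (a : R) f, 0 < a -> C1c a f ->
  F f = - \int[mu]_x (derive1 f x * psi x).

Lemma C1c_Rintegral (a : R) f psi : C1c a f ->
  \int[mu]_x (derive1 f x * psi x) = \int[mu]_(x in `[- a, a]) (derive1 f x * psi x).
Proof.
move=> Cf; apply: Rintegral_support => x; rewrite /= in_itv/= -ler_norml => /negP.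
by rewrite -ltNge => /(C1c_derive1_out Cf) ->; rewrite mul0r.
Qed.

Definition step n c (x : R) : R := c (Num.floor (n%:R * x)).

Lemma measurable_step n c : measurable_fun setT (step n c).
Proof.
move=> _ Y mY; rewrite setTI.
have -> : step n c @^-1` Y = \bigcup_(i in [set i | Y (c i)])
    [set x : R | i%:~R <= n%:R * x < (i + 1)%:~R].
  apply/seteqP; split=> x.
    by move=> Yx; exists (Num.floor (n%:R * x)) => //=; exact: floor_itv.
  by move=> [i Yi /= /floor_def E]; rewrite /preimage /step E.
(* The condition on the index becomes intersection with a set that is everything or empty, which
   gives a union over all of [int]. *)
have := @countable_bigcupT_measurable _ _ int (fun i => [set x : R | i%:~R <= n%:R * x < (i + 1)%:~R] `&` [set x | Y (c i)]).
have -> : \bigcup_i ([set x : R | i%:~R <= n%:R * x < (i + 1)%:~R] `&` [set x | Y (c i)]) =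
    \bigcup_(i in [set i | Y (c i)]) [set x : R | i%:~R <= n%:R * x < (i + 1)%:~R].
  by apply/seteqP; split=> x; [move=> [i _ [? ?]]; exists i|move=> [i ? ?]; exists i].
apply; first exact: countableP.
move=> i; apply: measurableI; last by have [?|?] := pselect (Y (c i));
  [rewrite (_ : mkset _ = setT)//; apply/seteqP; split|
   rewrite (_ : mkset _ = set0)//; apply/seteqP; split].
have mn : measurable_fun setT (fun x : R => n%:R * x) by exact: measurable_funM.
have -> : [set x : R | i%:~R <= n%:R * x < (i + 1)%:~R] =
    setT `&` (fun x : R => n%:R * x) @^-1` `[i%:~R, (i + 1)%:~R[.
  by rewrite setTI; apply/seteqP; split=> x /=; rewrite in_itv.
exact: mn.
Qed.

Lemma floor_bound n (k : nat) (x : R) : `|x| <= k%:R ->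
  (`|Num.floor (n%:R * x)| <= n * k)%N.
Proof.
rewrite ler_norml => /andP[x1 x2].
have h1 : - (n * k)%:Z <= Num.floor (n%:R * x).
  rewrite floor_ge_int rmorphN/= -pmulrn natrM -mulrN ler_wpM2l//.
have h2 : Num.floor (n%:R * x) <= (n * k)%:Z.
  rewrite -(ler_int R) (le_trans (floor_le _))// -pmulrn natrM ler_wpM2l//.
lia.
Qed.

Lemma step_bounded n c (k : nat) : exists C : R, forall x, `|x| <= k%:R -> `|step n c x| <= C.
Proof.
(* A crude substitute for the maximum over the finitely many cells meeting [-k, k]; each natural [j]
   carries both signs. *)
exists (\sum_(j < (n * k).+1) (`|c j%:Z| + `|c (- j%:Z)|)) => x /(floor_bound n).
rewrite /step; set i := Num.floor _ => ik.
have ik' : (`|i| < (n * k).+1)%N by [].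
rewrite (bigD1 (Ordinal ik'))//=.
apply: ler_wpDr; first by apply: sumr_ge0 => j _; exact: addr_ge0.
have [->|->] : i = `|i|%:Z \/ i = - `|i|%:Z by lia.
  by rewrite absz_nat lerDl.
by rewrite abszN absz_nat lerDr.
Qed.

Lemma step_locally_bounded n c : locally_bounded (step n c).
Proof.
split; first exact: measurable_step.
move=> K; have [C HC] := step_bounded n c (Num.truncn `|K|).+1.
exists C => x xK; apply: HC; apply: (le_trans xK); apply: (le_trans (ler_norm K)).
by apply: ltW; exact: truncnS_gt.
Qed.

(** [v0] plays the part of the value of [v] at index -1. *)
Lemma summation_by_parts (u v : nat -> R) (v0 : R) m :
  u 0%N * (v 0%N - v0) + \sum_(j < m) u j.+1 * (v j.+1 - v j) =
  u m * v m - u 0%N * v0 - \sum_(j < m) (u j.+1 - u j) * v j.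
Proof.
elim: m => [|m IH]; first by rewrite !big_ord0; ring.
by rewrite !big_ord_recr/= addrA IH; ring.
Qed.

(** On each cell the step function is constant and the fundamental theorem integrates f'. The shift
    by [N] lets natural indices reach the negative lattice points. *)
Lemma step_integral n c (a : R) (f : R -> R) (N m : nat) : (0 < n)%N ->
  (forall x, derivable f x 1) -> continuous (derive1 f) ->
  let x_ (j : nat) : R := (j%:Z - N%:Z)%:~R / n%:R in
  \int[mu]_(x in `[x_ 0%N, x_ m]) (derive1 f x * step n c x) =
  \sum_(j < m) (f (x_ j.+1) - f (x_ j)) * c (j%:Z - N%:Z).
Proof.
move=> n0 df cf x_.
have n0' : 0 < n%:R :> R by rewrite ltr0n.
have lf : locally_bounded (fun x => derive1 f x * step n c x).
  split; first by apply: measurable_funM; [exact: continuous_measurable_fun|exact: measurable_step].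
  move=> K; have [C1 H1] := (step_locally_bounded n c).2 K.
  have [C2 H2] : exists C : R, forall x, `|x| <= K -> `|derive1 f x| <= C.
    have [K0|K0] := leP 0 K; last first.
      by exists 0 => x /le_lt_trans/(_ K0); rewrite ltNge normr_ge0.
    have KK : - K <= K by lra.
    have cn : {within `[- K, K], continuous (fun x => `|derive1 f x|)}.
      apply: continuous_subspaceT => x; apply: continuous_comp; first exact: cf.
      exact: norm_continuous.
    have [d _ dmax] := EVT_max KK cn.
    by exists `|derive1 f d| => x xK; apply: dmax; rewrite in_itv/= -ler_norml.
  by exists (C2 * C1) => x xK; rewrite normrM ler_pM// ?H1 ?H2.
have x_S j : x_ j <= x_ j.+1.
  by rewrite /x_ ler_pM2r ?invr_gt0// ler_int; lia.
have x0_ j : x_ 0%N <= x_ j.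
  by rewrite /x_ ler_pM2r ?invr_gt0// ler_int; lia.
elim: m => [|m IH]; first by rewrite big_ord0 set_itv1 Rintegral_set1.
rewrite big_ord_recr/= -IH; apply/eqP; rewrite -subr_eq0 opprD addrA subr_eq0.
rewrite Rintegral_itv_diff//.
have itg := locally_bounded_integrable (x_ m) (x_ m.+1) lf.
have cfi : mu.-integrable `[x_ m, x_ m.+1] (EFin \o derive1 f).
  by apply: continuous_compact_integrable; [exact: segment_compact|exact: continuous_subspaceT].
(* The right end of the cell is dropped because the step function already takes its next value
   there. *)
rewrite -Rintegral_itv_bndo_bndc; last first.
  by apply: integrableS itg => //; exact: subset_itv_co_cc.
have -> : \int[mu]_(x in `[x_ m, x_ m.+1[) (derive1 f x * step n c x) =
    \int[mu]_(x in `[x_ m, x_ m.+1[) (derive1 f x * c (m%:Z - N%:Z)).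
  apply: eq_Rintegral => x; rewrite inE/= in_itv/= => /andP[xm xM]; congr (_ * _).
  rewrite /step; congr c; apply: floor_def; apply/andP; split.
    by rewrite mulrC -ler_pdivrMr.
  rewrite mulrC -ltr_pdivlMr//; move: xM; rewrite /x_.
  by have -> : m.+1%:Z - N%:Z = m%:Z - N%:Z + 1 by lia.
rewrite RintegralZr//; last by apply: integrableS cfi => //; exact: subset_itv_co_cc.
rewrite Rintegral_itv_bndo_bndc; last by apply: integrableS cfi => //; exact: subset_itv_co_cc.
by rewrite Rintegral_derive1.
Qed.

(** The integral of f' against the step function is a sum of increments of f times [c]; summation by
    parts moves the differences onto [c]. *)
Lemma step_derivative n c (e : int -> R) (q : R) : (0 < n)%N ->
  (forall i, q * e i = c i - c (i - 1)) ->
  derivative_of (fun f => q * \sum_(i \in [set: int]) (f (i%:~R / n%:R) * e i)) (step n c).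
Proof.
move=> n0 ec a f a0 Cf0.
have n0' : 0 < n%:R :> R by rewrite ltr0n.
(* An integer radius makes -k and k lattice points, with indices 0 and 2N for N = n k. As [f]
   vanishes there, the boundary terms drop out. *)
pose k := (Num.truncn a).+1.
have ak : a <= k%:R by apply: ltW; exact: truncnS_gt.
have Cf : C1c (k%:R) f by exact: C1cW Cf0.
pose N := (n * k)%N.
pose x_ (j : nat) : R := (j%:Z - N%:Z)%:~R / n%:R.
have x0E : x_ 0%N = - k%:R.
  by rewrite /x_ sub0r rmorphN/= -pmulrn natrM mulNr mulrAC divff ?gt_eqF// mul1r.
have xNE : x_ (N + N)%N = k%:R.
  by rewrite /x_ PoszD addrK -pmulrn natrM mulrAC divff ?gt_eqF// mul1r.
have [df cf f0] := Cf.
rewrite (C1c_Rintegral _ Cf) -x0E -xNE step_integral//.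
pose r := [seq j%:Z - N%:Z | j <- iota 0 (N + N).+1].
rewrite (fsbigE r)//; last 2 first.
- by rewrite map_inj_uniq ?iota_uniq// => i j; lia.
- move=> i _ ir; rewrite f0 ?mul0r//.
  rewrite normrM normfV (gtr0_norm n0') ler_pdivlMr// -natrM -intr_norm.
  rewrite pmulrn ler_int.
  have : ~ (0 <= i + N%:Z <= (N + N)%:Z).
    move=> h; move/negP: ir; apply; apply/mapP; exists (absz ((i : int) + N%:Z)); last lia.
    by rewrite mem_iota; lia.
  lia.
rewrite (eq_bigl xpredT); last by move=> i; rewrite in_setT.
rewrite big_distrr/= (eq_bigr (fun i => f (i%:~R / n%:R) * (c i - c (i - 1)))); last first.
  by move=> i _; rewrite mulrCA ec.
rewrite big_map -[iota _ _]/(0%N :: iota 1 (N + N)) big_cons.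
rewrite (iotaDl 1 0) big_map.
have := @summation_by_parts (fun j => f (x_ j)) (fun j => c (j%:Z - N%:Z)) (c (0%:Z - N%:Z - 1)) (N + N).
rewrite x0E xNE f0 ?normrN ?ger0_norm// (f0 k%:R) ?ger0_norm// !mul0r subr0 !add0r => <-.
rewrite -[X in _ = X](big_mkord xpredT (fun j => f (x_ j.+1) * (c (j.+1%:Z - N%:Z) - c (j%:Z - N%:Z)))).
have e0 : (- N%:Z)%:~R / n%:R = x_ 0%N by rewrite /x_ sub0r.
rewrite e0 x0E f0 ?normrN ?ger0_norm// mul0r [LHS]add0r /index_iota subn0.
apply: eq_bigr => j _; rewrite add1n; congr (_ * (_ - c _)); lia.
Qed.

End StepFunctionals.

(** * Local H^{-1} estimates and the metric [Rmetric] *)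

Section LocalSobolev.
Context {R : realType}.
Notation mu := (@lebesgue_measure R).
Implicit Types (f psi : R -> R) (F : (R -> R) -> R).

Lemma locally_bounded_C1c (a : R) f : 0 < a -> C1c a f ->
  locally_bounded f /\ locally_bounded (derive1 f).
Proof.
move=> a0 Cf; have [M _ HM] := C1c_bounded a0 Cf; have [_ cf _] := Cf.
split; split; [|by move=> K; exists M => x _; case: (HM x)| |by move=> K; exists M => x _; case: (HM x)].
- exact: (continuous_measurable_fun (C1c_continuous Cf)).
- exact: continuous_measurable_fun.
Qed.

Lemma locally_boundedM f psi : locally_bounded f -> locally_bounded psi ->
  locally_bounded (fun x => f x * psi x).
Proof.
move=> [mf bf] [mp bp]; split; first exact: measurable_funM.
move=> K; have [C HC] := bf K; have [D HD] := bp K.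
by exists (C * D) => x xK; rewrite normrM ler_pM// ?HC ?HD.
Qed.

Lemma locally_boundedB f psi : locally_bounded f -> locally_bounded psi ->
  locally_bounded (fun x => f x - psi x).
Proof.
move=> [mf bf] [mp bp]; split; first exact: measurable_funB.
move=> K; have [C HC] := bf K; have [D HD] := bp K.
by exists (C + D) => x xK; rewrite (le_trans (ler_normB _ _))// lerD// ?HC ?HD.
Qed.

Lemma locally_bounded_sqr f : locally_bounded f -> locally_bounded (fun x => f x ^+ 2).
Proof. by move=> lf; exact: (locally_boundedM lf lf). Qed.

Lemma EFin_Rintegral (D : set R) f : measurable D -> mu.-integrable D (EFin \o f) ->
  (\int[mu]_(x in D) f x)%:E = (\int[mu]_(x in D) (f x)%:E)%E.
Proof. by move=> mD iF; rewrite /Rintegral fineK//; apply: integrable_fin_num. Qed.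

Lemma Rintegral_sqr_le (a C : R) psi : 0 < a -> locally_bounded psi ->
  (forall x, `|x| <= a -> `|psi x| <= C) ->
  (\int[mu]_(x in `[(- a)%R, a]) (psi x ^+ 2)%:E <= (C ^+ 2 * (2 * a))%:E)%E.
Proof.
move=> a0 lp pC; have lp2 := locally_bounded_sqr lp.
rewrite -EFin_Rintegral//; last exact: locally_bounded_integrable.
have -> : 2 * a = a - - a by ring.
rewrite lee_fin; apply: Rintegral_itv_le => //; first lra.
move=> s s1 s2; rewrite -(@real_normK _ (psi s)) ?num_real//.
have h : `|psi s| <= C by apply: pC; rewrite ler_norml s1.
by rewrite lerXn2r ?nnegrE// (le_trans _ h).
Qed.

Lemma C1c_lin (a k : R) f h : C1c a f -> C1c a h ->
  C1c a (fun x => k * f x + h x) /\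
  derive1 (fun x => k * f x + h x) = fun x => k * derive1 f x + derive1 h x.
Proof.
move=> [df cf f0] [dh ch h0].
have E : derive1 (fun x => k * f x + h x) = fun x => k * derive1 f x + derive1 h x.
  apply/funext => x; rewrite !derive1E.
  transitivity ('D_1 (k \*: f + h) x) => //.
  by rewrite (deriveD (derivableZ (df x)) (dh x)) (deriveZ _ (df x)).
split; last exact: E.
split.
- by move=> x; apply: derivableD => //; exact: derivableZ.
- by rewrite E => x; apply: cvgD; [apply: cvgMr; exact: cf|exact: ch].
- by move=> x ax; rewrite f0// h0// mulr0 addr0.
Qed.

Lemma derivative_of_distribution F psi : derivative_of F psi -> locally_bounded psi ->
  distribution_on_R F.
Proof.
move=> Fpsi lp; split.
  move=> k f h /test_C1c[a a0 Cf] /test_C1c[b b0 Ch].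
  have ab0 : 0 < a + b by exact: addr_gt0.
  have {}Cf : C1c (a + b) f by apply: C1cW Cf; rewrite lerDl ltW.
  have {}Ch : C1c (a + b) h by apply: C1cW Ch; rewrite lerDr ltW.
  have [Cfh E] := C1c_lin k Cf Ch.
  rewrite (Fpsi _ _ ab0 Cfh) (Fpsi _ _ ab0 Cf) (Fpsi _ _ ab0 Ch).
  rewrite (C1c_Rintegral _ Cfh) (C1c_Rintegral _ Cf) (C1c_Rintegral _ Ch) E.
  have itg (g : R -> R) : C1c (a + b) g ->
      mu.-integrable `[- (a + b), a + b] (EFin \o (fun x => derive1 g x * psi x)).
    by move=> Cg; apply/locally_bounded_integrable/locally_boundedM => //;
       case: (locally_bounded_C1c ab0 Cg).
  have -> : \int[mu]_(x in `[- (a + b), a + b]) ((k * derive1 f x + derive1 h x) * psi x) =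
      \int[mu]_(x in `[- (a + b), a + b]) (k * (derive1 f x * psi x) + derive1 h x * psi x).
    by apply: eq_Rintegral => x _; rewrite mulrDl mulrA.
  rewrite RintegralD//; [|exact: integrable_scale (itg _ Cf)|exact: itg].
  by rewrite RintegralZl//; [rewrite opprD mulrN|exact: itg].
move=> K /compact_bounded[r [_ Kr]].
pose a := `|r| + 2.
have a0 : 0 < a by rewrite ltr_wpDl.
have Ka x : K x -> `|x| < a.
  move=> Kx; apply: (@le_lt_trans _ _ (`|r| + 1)); last by rewrite /a; lra.
  by apply: Kr => //; rewrite (le_lt_trans (ler_norm _))// ltrDl.
have [C HC] := lp.2 a.
have C0 : 0 <= C by rewrite (le_trans _ (HC 0 _))// normr0 ltW.
(* The distribution has order at most 1: [C] bounds [psi] on [-a, a], an interval of length 2a, and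
   only the supremum of |f'| is needed. *)
exists (C * (2 * a)), 1%N => f tf fK.
have [b b0 Cfb] := test_C1c tf.
have Cf : C1c a f.
  case: Cfb => df cf _; split=> // x ax; apply: fK => /Ka; rewrite ltNge => /negP; exact.
have [M M0 HM] := C1c_bounded a0 Cf.
rewrite (Fpsi _ _ a0 Cf) (C1c_Rintegral _ Cf) normrN.
have sub (h : R -> R) x : (forall x, `|h x| <= M) -> `|h x| <= sup [set `|h x| | x in setT].
  move=> hM; apply: sup_upper_bound; last by exists x.
  by split; [exists `|h 0|, 0|exists M => _ [z _ <-]].
have s1 x := sub (derive1 f) x (fun z => (HM z).2).
have s0 := le_trans (normr_ge0 _) (sub f 0 (fun z => (HM z).1)).
set S := sup [set `|derive1 f x| | x in setT].
apply: (@le_trans _ _ (S * C * (a - - a))).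
  apply: Rintegral_itv_norm_le; [|lra|].
    by apply: locally_boundedM => //; case: (locally_bounded_C1c a0 Cf).
  move=> s as1 as2; rewrite normrM ler_pM//.
  by apply: HC; rewrite ler_norml as1.
have -> : S * C * (a - - a) = C * (2 * a) * S by ring.
apply: ler_wpM2l; first by rewrite !mulr_ge0// ltW.
by rewrite big_ord_recr big_ord1/= [X in _ <= _ + X](_ : _ = S)// lerDr.
Qed.

Variables (b : R -> R) (Hb : is_bump b).

Lemma derivative_of_Hminus1_loc F psi : derivative_of F psi -> locally_bounded psi ->
  Hminus1_loc F.
Proof.
move=> Fpsi lp; split; first exact: derivative_of_distribution Fpsi lp.
move=> chi tchi; have [a a0 Cchi] := test_C1c tchi.
have [M M0 HM] := C1c_bounded a0 Cchi.
have [C HC] := lp.2 a.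
have C0 : 0 <= C by rewrite (le_trans _ (HC 0 _))// normr0 ltW.
(* The integral of psi^2 is at most C^2 times 2a, and (1 + 2a)^2 >= 2a avoids a square root. *)
apply: (proj1 (@Hminus1_of_weight R b Hb (mulD chi F) a C M (C * (1 + 2 * a)) chi psi _ _ _ _ _ _ _ _)) => //.
- by rewrite mulr_ge0//; lra.
- by case: lp => mp _; exact: measurable_funTS.
- by move=> x; rewrite in_itv/= -ler_norml; exact: HC.
- apply: (le_trans (Rintegral_sqr_le a0 lp HC)); rewrite lee_fin exprMn ler_wpM2l ?sqr_ge0//.
  nra.
move=> f tf; have [sf _] := tf.
have Cchif : C1c a (fun x => chi x * f x).
  apply: C1cM => //; first by move=> x; exact: smooth_derivable.
  exact: smooth_derive1_continuous.
by rewrite /mulD (Fpsi _ _ a0 Cchif) (C1c_Rintegral _ Cchif).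
Qed.

Lemma Hminus1_norm_cutoff_sub (a M e : R) (chi psi1 psi2 : R -> R) (F1 F2 : (R -> R) -> R) :
  0 < a -> 0 <= e -> C1c a chi -> (forall x, `|chi x| <= M /\ `|derive1 chi x| <= M) ->
  derivative_of F1 psi1 -> derivative_of F2 psi2 ->
  locally_bounded psi1 -> locally_bounded psi2 ->
  (\int[mu]_(x in `[(- a)%R, a]) ((psi1 x - psi2 x) ^+ 2)%:E <= (e ^+ 2)%:E)%E ->
  (Hminus1_norm (subD (mulD chi F1) (mulD chi F2)) <= (M * e)%:E)%E.
Proof.
move=> a0 e0 Cchi HM F1p F2p l1 l2 pe.
have [C HC] := (locally_boundedB l1 l2).2 a.
apply: (proj2 (@Hminus1_of_weight R b Hb _ a C M e chi (fun x => psi1 x - psi2 x) _ _ _ _ _ _ _ _)) => //.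
- by case: (locally_boundedB l1 l2) => mp _; exact: measurable_funTS.
- by move=> x; rewrite in_itv/= -ler_norml; exact: HC.
move=> f tf; have [sf _] := tf.
have Cchif : C1c a (fun x => chi x * f x).
  apply: C1cM => //; first by move=> x; exact: smooth_derivable.
  exact: smooth_derive1_continuous.
rewrite /subD /mulD (F1p _ _ a0 Cchif) (F2p _ _ a0 Cchif) !(C1c_Rintegral _ Cchif).
have itg psi : locally_bounded psi ->
    mu.-integrable `[- a, a] (EFin \o (fun x => derive1 (fun x => chi x * f x) x * psi x)).
  by move=> lp; apply/locally_bounded_integrable/locally_boundedM => //;
     case: (locally_bounded_C1c a0 Cchif).
rewrite opprK addrC -[LHS]opprK opprB -RintegralB//; [|exact: itg..].
by congr (- _); apply: eq_Rintegral => x _; rewrite mulrBr.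
Qed.

(** Each operator norm is a supremum of absolute values, over a set that contains the zero function.
    Placing it in the unit ball needs uniqueness of weak derivatives, as the one chosen for 0 is
    known to vanish only almost everywhere. *)
Lemma Hminus1_norm_ge0 F : (0 <= Hminus1_norm F)%E.
Proof.
apply: le_ereal_inf_tmp => _ [G _ <-].
have L0 : L2 (cst (0 : R)).
  by apply: L2_sqr => //=; apply: (@eq_integrable _ _ _ mu setT measurableT (cst 0%E));
     [move=> x _ /=; rewrite expr0n|exact: integrable0].
have C0 : C1c 1 (cst (0 : R)).
  have E : derive1 (cst (0 : R)) = cst 0 by apply/funext => x; rewrite derive1_cst.
  by split=> //; rewrite E => x; exact: cvg_cst.
have W0 := C1c_weak_derivative ltr01 C0.
have H0 := C1c_H1 ltr01 C0.
have W := weak_derivativeP H0.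
have ae0 := weak_derivative_unique Hb W W0.
apply: (@le_trans _ _ `|G (cst 0)|%:E); first by rewrite lee_fin.
apply: ereal_sup_ubound; exists (cst 0) => //; split=> //.
have n0 : (L2norm (cst 0%R : R -> R) <= (0%R : R)%:E)%E.
  apply: L2norm_sqr_le => //.
  by rewrite integral0_eq ?lee_fin ?sqr_ge0// => x _; rewrite expr0n.
have n1 : (L2norm (weak_derivative (cst 0%R : R -> R)) <= (0%R : R)%:E)%E.
  apply: L2norm_sqr_le => //.
  rewrite (@ae_eq_integral _ _ _ mu setT (cst 0%E))//.
  - by rewrite integral0 lee_fin sqr_ge0.
  - by apply/measurable_EFinP/measurable_funX; case: W => -[].
  - apply: filterS ae0 => x h _; rewrite h//.
    by rewrite (_ : derive1 (cst 0) x = 0) ?expr0n// derive1_cst.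
by rewrite /H1norm (le_trans (leeD n0 n1))// adde0 lee_fin.
Qed.

Variables (chi : nat -> R -> R).

Lemma Rmetric_ge0 F G : (0 <= Rmetric chi F G)%E.
Proof.
apply: nneseries_ge0 => k _ _; rewrite mule_ge0 ?lee_fin ?exprVn ?invr_ge0 ?exprn_ge0//.
by rewrite le_min lee01 Hminus1_norm_ge0.
Qed.

Lemma sum_halves_tail (c : nat -> R) (dl : R) (m N : nat) : 0 <= dl ->
  (forall k, (k <= m)%N -> c k <= dl) -> (forall k, c k <= 1) ->
  \sum_(1 <= k < N.+1) 2 ^- k * c k <= dl + 2 ^- m.
Proof.
move=> dl0 cm c1.
have p0 (k : nat) : 0 <= 2 ^- k :> R by rewrite invr_ge0 exprn_ge0.
have half (k : nat) : 2 ^- k = 2 ^- k.+1 + 2 ^- k.+1 :> R.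
  by rewrite [LHS]splitr !exprSr !invfM.
(* Exact remainders make the induction close: the weights up to N sum to 1 - 2^-N, and those from m
   + 1 to N sum to 2^-m - 2^-N. *)
suff [H1 H2] : ((N <= m)%N -> \sum_(1 <= k < N.+1) 2 ^- k * c k <= dl * (1 - 2 ^- N)) /\
    ((m <= N)%N -> \sum_(1 <= k < N.+1) 2 ^- k * c k <= dl + 2 ^- m - 2 ^- N).
  have [Nm|/ltnW mN] := leqP N m.
    apply: (le_trans (H1 Nm)); rewrite mulrBr mulr1.
    by have := mulr_ge0 dl0 (p0 N); have := p0 m; lra.
  by apply: (le_trans (H2 mN)); have := p0 N; lra.
elim: N => [|N [IH1 IH2]].
  rewrite big_geq//; split=> [_|]; first by rewrite expr0 invr1 subrr mulr0.
  by rewrite leqn0 => /eqP ->; lra.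
rewrite big_nat_recr//=; split=> [Nm|].
  apply: (le_trans (lerD (IH1 (ltnW Nm)) (ler_wpM2l (p0 _) (cm _ Nm)))).
  by rewrite (half N); lra.
rewrite leq_eqVlt => /predU1P[mN|mN].
  rewrite {}mN in IH1 cm *.
  apply: (le_trans (lerD (IH1 (leqnSn N)) (ler_wpM2l (p0 _) (cm _ (leqnn _))))).
  by rewrite (half N); have := mulr_ge0 dl0 (p0 N.+1); lra.
apply: (le_trans (lerD (IH2 mN) (ler_wpM2l (p0 _) (c1 _)))).
by rewrite (half N); lra.
Qed.

Lemma Rmetric_le F G (dl : R) (m : nat) : 0 <= dl ->
  (forall k, (0 < k)%N -> (k <= m)%N ->
    (Hminus1_norm (subD (mulD (chi k) F) (mulD (chi k) G)) <= dl%:E)%E) ->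
  (Rmetric chi F G <= (dl + 2 ^- m)%:E)%E.
Proof.
move=> dl0 Hk; rewrite /Rmetric.
pose c (k : nat) : R := if (k <= m)%N then Num.min 1 dl else 1.
have p0 (k : nat) : 0 <= 2 ^- k :> R by rewrite invr_ge0 exprn_ge0.
apply: lime_le.
  apply: is_cvg_nneseries => k _ _; rewrite mule_ge0 ?lee_fin//.
  by rewrite le_min lee01 Hminus1_norm_ge0.
apply: nearW => -[|N]; first by rewrite big_geq// lee_fin addr_ge0.
apply: (@le_trans _ _ (\sum_(1 <= k < N.+1) (2 ^- k * c k)%:E)%E).
  rewrite big_nat_cond [leRHS]big_nat_cond; apply: lee_sum => k /andP[/andP[k0 _] _].
  rewrite EFinM; apply: lee_wpmul2l; first by rewrite lee_fin.
  rewrite /c; case: ifPn => km; last by rewrite ge_min lexx.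
  by have [_|_] := leP 1 dl; rewrite ge_min ?lexx ?Hk ?orbT.
rewrite sumEFin lee_fin; apply: sum_halves_tail => //.
- by move=> k km; rewrite /c km ge_min lexx orbT.
- by move=> k; rewrite /c; case: ifP => // _; rewrite ge_min lexx.
Qed.

Lemma near_forall_leq (I : Type) (FF : set_system I) (Q : nat -> I -> Prop) (m : nat) :
  Filter FF -> (forall k, \forall i \near FF, Q k i) ->
  \forall i \near FF, forall k, (k <= m)%N -> Q k i.
Proof.
move=> FFF HQ; elim: m => [|m IH].
  by apply: filterS (HQ 0%N) => i h k; rewrite leqn0 => /eqP ->.
apply: filterS2 IH (HQ m.+1) => i h1 h2 k; rewrite leq_eqVlt => /predU1P[->//|].
by rewrite ltnS; exact: h1.
Qed.

(** Half of e absorbs the tail of the series, uniformly in everything; only finitely many cutoffs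
    remain, so their neighbourhoods can be intersected. *)
Lemma Rmetric_near (I T : Type) (FF : set_system I) (D : set T)
    (F1 F2 : I -> T -> (R -> R) -> R) : Filter FF ->
  (forall k (dl : R), (0 < k)%N -> 0 < dl -> \forall i \near FF, forall t, D t ->
    (Hminus1_norm (subD (mulD (chi k) (F1 i t)) (mulD (chi k) (F2 i t))) <= dl%:E)%E) ->
  forall e : R, 0 < e ->
    \forall i \near FF, forall t, D t -> (Rmetric chi (F1 i t) (F2 i t) <= e%:E)%E.
Proof.
move=> FFF H e e0; have e2 : 0 < e / 2 by rewrite divr_gt0.
(* Any m above 2 / e will do, since m < 2^m. *)
have [m Hm] : exists m : nat, 2 ^- m <= e / 2.
  exists (Num.truncn (e / 2)^-1).+1.
  rewrite -[leRHS]invrK lef_pV2 ?posrE ?invr_gt0 ?exprn_gt0//.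
  apply: (le_trans (ltW (truncnS_gt _))).
  by rewrite -natrX ler_nat ltnW// ltn_expl.
have : \forall i \near FF, forall k, (k <= m)%N -> (0 < k)%N -> forall t, D t ->
    (Hminus1_norm (subD (mulD (chi k) (F1 i t)) (mulD (chi k) (F2 i t))) <= (e / 2)%:E)%E.
  apply: near_forall_leq => -[|k]; first by apply: nearW.
  by apply: filterS (H k.+1 _ isT e2) => i h _.
apply: filterS => i Hi t Dt.
apply: (le_trans (@Rmetric_le _ _ (e / 2) m (ltW e2) _)).
  by move=> k k0 km; exact: Hi.
by rewrite lee_fin; lra.
Qed.

End LocalSobolev.

(** * Bounding the Skorokhod distance by uniform distances *)

Section SkorokhodBound.
Context {R : realType}.
Notation mu := (@lebesgue_measure R).

(** Measurability is not assumed because [stopped_dist] is a supremum over uncountably many times.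
    The integral of a nonnegative function is a supremum over simple functions below it, hence
    monotone in any case. *)
Lemma ge0_integral_mono (D : set R) (f h : R -> \bar R) :
  (forall x, D x -> 0 <= f x)%E -> (forall x, D x -> f x <= h x)%E ->
  (\int[mu]_(x in D) f x <= \int[mu]_(x in D) h x)%E.
Proof.
move=> f0 fh; have h0 x : D x -> (0 <= h x)%E by move=> Dx; exact: le_trans (f0 _ Dx) (fh _ Dx).
rewrite (@ge0_integralE _ _ _ mu D f f0) (@ge0_integralE _ _ _ mu D h h0).
apply: ereal_sup_le => _ [s /= sf <-]; exists s => //= x; apply: (le_trans (sf x)).
by rewrite /patch; case: ifPn => // /set_mem; exact: fh.
Qed.

Lemma integral_expRN (a : R) : (\int[mu]_(v in `[a, +oo[) (expR (- v))%:E = (expR (- a))%:E)%E.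
Proof.
have dE (x : R) : is_derive x 1 (fun v => - expR (- v)) (expR (- x)).
  have := @is_derive1_comp R expR -%R x (expR (- x)) (-1) _ _ => H.
  have h : is_derive x 1 (fun v => expR (- v)) (expR (- x) * -1).
    by apply: H.
  by apply: is_derive_eq; rewrite mulrN1 opprK.
rewrite (@ge0_continuous_FTC2y R _ (fun v => - expR (- v)) a 0).
- by rewrite sub0e EFinN oppeK.
- by move=> x _; exact: expR_ge0.
- apply: continuous_subspaceT => x; apply: (continuous_comp (f := -%R)); first exact: opp_continuous.
  exact: continuous_expR.
- by rewrite -oppr0; apply: cvgN; exact: cvgr_expR.
- by move=> x _; case: (dE x).
- have : continuous (fun v : R => - expR (- v)).
    by apply: derivable_continuous => x; case: (dE x).
  by move=> c; apply: cvg_at_right_filter; exact: c.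
- by move=> x _; rewrite derive1E; case: (dE x).
Qed.

Lemma time_change_id : time_change (id : R -> R) /\ log_slope (id : R -> R) = 0%E.
Proof.
have l0 : log_slope (id : R -> R) = 0%E.
  apply/eqP; rewrite eq_le; apply/andP; split.
    apply: ge_ereal_sup => _ [p /= /andP[_ p12] <-].
    by rewrite divff ?ln1 ?normr0// subr_eq0 gt_eqF.
  apply: ereal_sup_ubound; exists (0, 1) => /=; first by rewrite lexx ltr01.
  by rewrite !subr0 divff// ln1 normr0.
split=> //; split=> //; last by rewrite l0.
by rewrite image_id.
Qed.

Lemma skorokhod_dist_ge0 (T : Type) (r : T -> T -> \bar R) (x y : R -> T) :
  (0 <= skorokhod_dist r x y)%E.
Proof.
apply: le_ereal_inf_tmp => _ [lam _ <-]; rewrite le_max; apply/orP; left.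
apply: (@le_trans _ _ (`|ln ((lam 1 - lam 0) / (1 - 0))|)%:E); first by rewrite lee_fin.
by apply: ereal_sup_ubound; exists (0, 1) => //=; rewrite lexx ltr01.
Qed.

(* With the identity as time change the distance is an average, with weight
   exp(-v), of the uniform distances over [0, v]. *)
Lemma skorokhod_dist_le (T : Type) (r : T -> T -> \bar R) (x y : R -> T) (N e : R) :
  0 <= N -> 0 <= e -> (forall a b, 0 <= r a b)%E ->
  (forall t, 0 <= t -> t <= N -> (r (x t) (y t) <= e%:E)%E) ->
  (skorokhod_dist r x y <= (e + expR (- N))%:E)%E.
Proof.
move=> N0 e0 r0 re; have [tid lid] := time_change_id.
have e0' := expR_ge0 (- N).
apply: (@le_trans _ _ (maxe (log_slope (id : R -> R)) (\int[mu]_(v in `[0%R, +oo[)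
  ((expR (- v))%:E * stopped_dist r x y id v))%E)).
  by apply: ereal_inf_lbound; exists id.
rewrite ge_max lid lee_fin addr_ge0//=.
have S0 v : (0 <= stopped_dist r x y id v)%E.
  apply: (@le_trans _ _ (mine (r (x (Num.min 0 v)) (y (Num.min 0 v))) 1%E)).
    by rewrite le_min r0 lee01.
  by apply: ereal_sup_ubound; exists 0 => //=; rewrite in_itv/= lexx.
have S1 v : (stopped_dist r x y id v <= 1)%E.
  by apply: ge_ereal_sup => _ [t _ <-]; rewrite ge_min lexx orbT.
have Se v : 0 <= v -> v <= N -> (stopped_dist r x y id v <= e%:E)%E.
  move=> v0 vN; apply: ge_ereal_sup => _ [t /= + <-]; rewrite in_itv/= andbT => t0.
  rewrite ge_min; apply/orP; left; apply: re; first by rewrite le_min t0.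
  by rewrite ge_min vN orbT.
have mexp (D : set R) : measurable_fun D (fun v => (expR (- v))%:E).
  apply/measurable_EFinP; apply: measurable_funTS; apply: continuous_measurable_fun => v.
  apply: (continuous_comp (f := -%R)); first exact: opp_continuous.
  exact: continuous_expR.
(* For v beyond [N] only the truncation of the distance at 1 is available; the weight left there
   integrates to exp(-N). *)
pose tailf : R -> \bar R := (fun v : R => (expR (- v))%:E) \_ `[N, +oo[.
have mtail : measurable_fun (`[0, +oo[%classic : set R) tailf.
  by apply: measurable_funTS; exact: ((measurable_restrictT (fun v : R => (expR (- v))%:E) (measurable_itv _)).1 (mexp _)).
have exp0 v : (0 <= (expR (- v))%:E :> \bar R)%E by rewrite lee_fin expR_ge0.
have tail0 v : (0 <= tailf v)%E by rewrite /tailf /patch; case: ifP.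
apply: (@le_trans _ _ (\int[mu]_(v in `[0%R, +oo[) (e%:E * (expR (- v))%:E + tailf v))%E).
  apply: ge0_integral_mono => v /=; rewrite in_itv/= andbT => v0; first by rewrite mule_ge0.
  have [vN|Nv] := leP v N.
    apply: (@le_trans _ _ (e%:E * (expR (- v))%:E)%E); last by rewrite leeDl.
    by rewrite muleC lee_wpmul2r// Se.
  rewrite /tailf patchT ?inE/= ?in_itv/= ?(ltW Nv)//.
  apply: (@le_trans _ _ (expR (- v))%:E); last by rewrite leeDr// mule_ge0.
  by rewrite -[leRHS]mule1 lee_wpmul2l.
rewrite ge0_integralD//=; last 2 first.
- by move=> v _; rewrite mule_ge0.
- by apply: measurable_funeM; exact: mexp.
rewrite ge0_integralZl//; last exact: mexp.
have -> : (\int[mu]_(v in `[0%R, +oo[) tailf v = \int[mu]_(v in `[N, +oo[) (expR (- v))%:E)%E.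
  rewrite /tailf -integral_mkcondr; congr integral; apply/seteqP; split=> v /=;
    rewrite !in_itv/= !andbT; [by case|by move=> Nv; split=> //; exact: le_trans N0 Nv].
by rewrite !integral_expRN oppr0 expR0 mule1 EFinD.
Qed.

(** Bridges dominated convergence, which is about sequences, and continuity along a filter of
    nonnegative times. If [Q] failed arbitrarily near t, bad times within 1/(n+1) of t would form a
    forbidden sequence. *)
Lemma near_within_nonneg (t : R) (Q : R -> Prop) :
  (forall s_ : nat -> R, (forall n, 0 <= s_ n) -> s_ @ \oo --> t ->
     \forall n \near \oo, Q (s_ n)) ->
  \forall s \near within `[0, +oo[ (nbhs t), Q s.
Proof.
move=> H; apply: contrapT => nQ.
have h (n : nat) : exists s : R, [/\ 0 <= s, `|t - s| < n.+1%:R^-1 & ~ Q s].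
  apply: contrapT => hn; apply: nQ.
  have n0 : 0 < n.+1%:R^-1 :> R by rewrite invr_gt0.
  apply/nbhs_ballP; exists n.+1%:R^-1 => //= s ts; rewrite in_itv/= andbT => s0.
  by apply: contrapT => Qs; apply: hn; exists s.
pose s_ n := sval (cid (h n)).
have sP n : [/\ 0 <= s_ n, `|t - s_ n| < n.+1%:R^-1 & ~ Q (s_ n)] by rewrite /s_; case: cid.
have st : s_ @ \oo --> t.
  apply/cvgrPdist_lt => e e0; near=> n; have [_ tn _] := sP n; apply: (lt_le_trans tn).
  by rewrite ltW//; near: n; exact: near_infty_natSinv_lt (PosNum e0).
have [N _ HN] := H s_ (fun n => let: And3 a _ _ := sP n in a) st.
by have [_ _] := sP N; apply; apply: HN => /=.
Unshelve. all: by end_near. Qed.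

End SkorokhodBound.

(** * Local L^2 convergence of step functions *)

Section StepConvergence.
Context {R : realType}.
Notation mu := (@lebesgue_measure R).

Lemma continuous_locally_bounded (f : R -> R) : continuous f -> locally_bounded f.
Proof.
move=> cf; split; first exact: continuous_measurable_fun.
move=> K; have [K0|K0] := leP 0 K; last first.
  by exists 0 => x /le_lt_trans/(_ K0); rewrite ltNge normr_ge0.
have KK : - K <= K by lra.
have cn : {within `[- K, K], continuous (fun x => `|f x|)}.
  apply: continuous_subspaceT => x; apply: continuous_comp; first exact: cf.
  exact: norm_continuous.
have [d _ dmax] := EVT_max KK cn.
by exists `|f d| => x xK; apply: dmax; rewrite in_itv/= -ler_norml.
Qed.

Lemma locally_boundedZ (f : R -> R) (k : R) : locally_bounded f ->
  locally_bounded (fun x => k * f x).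
Proof.
move=> lf; apply: (@locally_boundedM _ (cst k) f) => //.
by split=> // K; exists `|k| => x _.
Qed.

(** For fixed n only finitely many cells meet [-k, k], so convergence of each coefficient is
    automatically uniform there. *)
Lemma near_step_L2 (FF : set_system R) (n k : nat) (cs : R -> int -> R) (cl : int -> R) (e : R) {FFF : Filter FF} :
  (0 < k)%N -> 0 < e -> (forall i, cs s i @[s --> FF] --> cl i) ->
  \forall s \near FF, (\int[mu]_(x in `[(- k%:R)%R, k%:R])
    ((step n (cs s) x - step n cl x) ^+ 2)%:E <= (e ^+ 2)%:E)%E.
Proof.
move=> k0 e0 ccl; have k0' : 0 < k%:R :> R by rewrite ltr0n.
(* Chosen so that d^2 times the length 2k is at most e^2. *)
pose d := e / (1 + 2 * k%:R).
have d0 : 0 < d by rewrite divr_gt0// addr_gt0// mulr_gt0.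
have := @near_forall_leq R FF (fun j s => `|cs s j%:Z - cl j%:Z| <= d /\
  `|cs s (- j%:Z) - cl (- j%:Z)| <= d) (n * k)%N FFF.
have nr i : \forall s \near FF, `|cs s i - cl i| <= d.
  have /cvgrPdist_le/(_ d d0) := ccl i; apply: filterS => s; by rewrite distrC.
move=> /(_ (fun j => filterI (nr _) (nr _))).
apply: filterS => s Hs.
apply: (le_trans (@Rintegral_sqr_le R k%:R d _ k0' _ _)).
- by apply: locally_boundedB; exact: step_locally_bounded.
- move=> x /(floor_bound n) ik; rewrite /step.
  have [h1 h2] := Hs _ ik.
  by have [->|->] : Num.floor (n%:R * x) = `|Num.floor (n%:R * x)|%N%:Z \/
    Num.floor (n%:R * x) = - `|Num.floor (n%:R * x)|%N%:Z by lia.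
rewrite lee_fin /d expr_div_n mulrAC ler_pdivrMr; last by rewrite exprn_gt0// addr_gt0// mulr_gt0.
by rewrite ler_wpM2l ?sqr_ge0//; have := k0'; nra.
Qed.

End StepConvergence.

(** * Properties of the cutoffs *)

Section CutoffFunctions.
Context {R : realType}.
Variable chi : nat -> R -> R.
Hypothesis chi_cutoffs : cutoffs chi.

Lemma cutoff_C1c k : (0 < k)%N -> C1c k%:R (chi k).
Proof.
move=> k0; have [tk _ Hk] := chi_cutoffs k0.
have [a a0 [dk ck _]] := test_C1c tk; split=> // x kx.
have /andP[h1 h2] := Hk x; apply/eqP; rewrite eq_le (le_trans h2)//=.
  by rewrite (le_trans _ h1)// indicE.
by rewrite indicE memNset// /= in_itv/= -ltr_norml ltNge kx.
Qed.

(** For k = 1 the interval of the lower indicator degenerates to the point 0, which forces the value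
    1 there. *)
Lemma cutoff_is_bump : is_bump (chi 1%N).
Proof.
have [tk _ Hk] := @chi_cutoffs 1%N isT.
have h01 x : 0 <= chi 1%N x <= 1.
  have /andP[h1 h2] := Hk x; apply/andP; split.
    by rewrite (le_trans _ h1)// indicE.
  by rewrite (le_trans h2)// indicE lern1 leq_b1.
split=> //; last by move=> x x1; case: (@cutoff_C1c 1%N isT) => _ _; exact.
apply/eqP; rewrite eq_le; case/andP: (h01 0) => _ -> /=.
have /andP[h1 _] := Hk 0; apply: le_trans h1.
by rewrite indicE mem_set//= in_itv/= addrC subrr lexx.
Qed.

End CutoffFunctions.

(** * Path regularity of the limit and of the prelimit fluctuations *)

Section DeterministicLimit.
Context {R : realType}.
Notation mu := (@lebesgue_measure R).
Variables (u0 b : R -> R) (chi : nat -> R -> R).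
Hypotheses (cont : continuous u0) (mono : {homo u0 : x y / x <= y})
  (boxes : forall K T, 0 < K -> 0 < T -> exists Y M, hopf_lax_box u0 K T Y M)
  (bcont : continuous b) (chi_cutoffs : cutoffs chi).

Let Hb := cutoff_is_bump chi_cutoffs.

Lemma min_value_locally_bounded t : 0 <= t -> locally_bounded (fun x => min_value u0 b x t).
Proof.
move=> t0; split; first exact: measurable_min_value.
move=> K; have [C _ HC] := min_value_bounded cont boxes bcont
  (ltr_wpDl (normr_ge0 K) (@ltr01 R)) (ltr_wpDl t0 (@ltr01 R)).
exists C => x xK; apply: HC => //; last by rewrite lerDl.
by rewrite (le_trans xK)// (le_trans (ler_norm _))// lerDl.
Qed.

Lemma hopf_lax_continuous t : 0 <= t -> continuous (fun x => hopf_lax u0 x t).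
Proof.
move=> t0; apply: local_lipschitz_continuous => K.
have [L L0 [HL _]] := hopf_lax_lipschitz cont mono boxes
  (ltr_wpDl (normr_ge0 K) (@ltr01 R)) (ltr_wpDl t0 (@ltr01 R)).
exists L => // x y Kx xy yK; have h := ler_norm K.
rewrite (le_trans (HL y x t _ _ t0 _))//; last by rewrite ger0_norm// subr_ge0.
- by rewrite ler_norml; lra.
- by rewrite ler_norml; lra.
- by rewrite lerDl.
Qed.

Lemma hopf_lax_time_cvg (x t : R) : 0 <= t ->
  hopf_lax u0 x s @[s --> within `[0, +oo[ (nbhs t)] --> hopf_lax u0 x t.
Proof.
move=> t0; have [L L0 [_ HL]] := hopf_lax_lipschitz cont mono boxes
  (ltr_wpDl (normr_ge0 x) (@ltr01 R)) (ltr_wpDl t0 (@ltr01 R)).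
apply/cvgrPdist_le => /= e e0.
have d0 : 0 < e / (L + 1) by rewrite divr_gt0// ltr_wpDl.
apply: filterS2 (nbhsx_ballx t _ d0) (nbhsx_ballx t _ (@ltr01 R)) => s ts ts1.
rewrite /= in_itv/= andbT => s0.
have {ts} : `|t - s| < e / (L + 1) by [].
have {ts1} : `|t - s| < 1 by [].
rewrite ltr_norml => /andP[h1 h2]; rewrite ltr_pdivlMr ?ltr_wpDl// => h3.
rewrite (le_trans (HL x t s _ t0 _ s0 _))//; [by rewrite lerDl|by rewrite lerDl|lra|].
have := normr_ge0 (t - s); nra.
Qed.

(** Dominated convergence along an arbitrary sequence of times: the shocks at time t are countable,
    hence null, and [min_value] is bounded on the box by a constant. The shift by [N] brings all
    times below t + 1. *)
Lemma near_min_value_L2 (t : R) (k : nat) (e : R) : 0 <= t -> (0 < k)%N -> 0 < e ->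
  \forall s \near within `[0, +oo[ (nbhs t), (\int[mu]_(x in `[(- k%:R)%R, k%:R])
    ((min_value u0 b x s - min_value u0 b x t) ^+ 2)%:E <= (e ^+ 2)%:E)%E.
Proof.
move=> t0 k0 e0; apply: near_within_nonneg => s_ s0 st.
have k0' : 0 < k%:R :> R by rewrite ltr0n.
have T0 : 0 < t + 1 by rewrite ltr_wpDl.
have [C C0 HC] := min_value_bounded cont boxes bcont k0' T0.
have [N _ HN] : \forall n \near \oo, s_ n < t + 1.
  by apply: (cvgr_lt t) => //; rewrite ltrDl.
pose D : set R := `[- k%:R, k%:R]%classic.
pose f_ n x : \bar R := ((min_value u0 b x (s_ (n + N)%N) - min_value u0 b x t) ^+ 2)%:E.
have lbd s : 0 <= s -> locally_bounded (fun x => (min_value u0 b x s - min_value u0 b x t) ^+ 2).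
  by move=> s0'; apply/locally_bounded_sqr/locally_boundedB; exact: min_value_locally_bounded.
have mf n : measurable_fun D (f_ n).
  by apply/measurable_EFinP; apply: measurable_funTS; case: (lbd _ (s0 (n + N)%N)).
have dist0 : {ae mu, forall x, D x -> f_ ^~ x @ \oo --> 0%E}.
  have c0 := countable_shocks cont boxes t0.
  exists (shocks u0 t); split; first exact: countable_measurable.
    exact: countable_lebesgue_measure0.
  move=> x /= nx; apply: contrapT => nsh; apply: nx => _.
  have := min_value_cvg cont boxes bcont t0 nsh s0 st.
  rewrite -(cvg_shiftn N) => h.
  apply: cvg0e_near_le => [n|d d0]; first by rewrite lee_fin sqr_ge0.
  have h1 : (fun n => min_value u0 b x (s_ (n + N)%N) - min_value u0 b x t) @ \oo --> (0 : R).
    by rewrite -(subrr (min_value u0 b x t)); exact: cvgB h (cvg_cst _).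
  have h2 : (min_value u0 b x (s_ (n + N)%N) - min_value u0 b x t) ^+ 2 @[n --> \oo] --> (0 : R).
    by have := cvgM h1 h1; rewrite mulr0; exact.
  have h3 : \forall n \near \oo, (min_value u0 b x (s_ (n + N)%N) - min_value u0 b x t) ^+ 2 <= d.
    exact: cvgr_le h2 d d0.
  by apply: filterS h3 => n; rewrite lee_fin.
have bnd : {ae mu, forall x n, D x -> (`|f_ n x| <= cst ((C + C) ^+ 2)%:E x)%E}.
  apply: aeW => x n; rewrite /D/= in_itv/= -ler_norml => xk.
  rewrite lee_fin ger0_norm ?sqr_ge0// -(@real_normK _ (_ - _)) ?num_real//.
  rewrite lerXn2r ?nnegrE ?addr_ge0// (le_trans (ler_normB _ _))// lerD// HC//.
    by rewrite ltW// HN//= leq_addl.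
  by rewrite lerDl.
have int : mu.-integrable D (cst ((C + C) ^+ 2)%:E).
  exact: (integrable_cst_fin ((C + C) ^+ 2) (measurable_itv _) (itv_finite_measure _ _)).
have [_ _] := @dominated_convergence _ _ R mu D (measurable_itv _) f_ (cst 0%E)
   (cst ((C + C) ^+ 2)%:E) mf (measurable_cst _) dist0 int bnd.
rewrite integral0 => h.
have e20 : 0 < e ^+ 2 by rewrite exprn_gt0.
have [N' _ HN'] : \forall n \near \oo, (\int[mu]_(x in D) f_ n x < (e ^+ 2)%:E)%E.
  exact: near_lt_cvg0e.
exists (N' + N)%N => // n /= nN; apply: ltW.
have := HN' (n - N)%N; rewrite /= /f_ subnK; last by rewrite (leq_trans _ nN)// leq_addl.
by apply; rewrite leq_subRL ?(leq_trans _ nN) ?leq_addl// addnC.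
Qed.

(** Local L^2 closeness of primitives controls [Rmetric], uniformly in the parameter t. An L^2 error
    dl / M suffices for the k-th cutoff, where [M] bounds it and its derivative. *)
Lemma Rmetric_near_L2 (I T : Type) (FF : set_system I) (D : set T)
    (F1 F2 : I -> T -> (R -> R) -> R) (psi1 psi2 : I -> T -> R -> R) : Filter FF ->
  (\forall i \near FF, forall t, D t -> [/\ derivative_of (F1 i t) (psi1 i t),
     derivative_of (F2 i t) (psi2 i t), locally_bounded (psi1 i t) & locally_bounded (psi2 i t)]) ->
  (forall (k : nat) (e : R), (0 < k)%N -> 0 < e -> \forall i \near FF, forall t, D t ->
     (\int[mu]_(x in `[(- k%:R)%R, k%:R]) ((psi1 i t x - psi2 i t x) ^+ 2)%:E <= (e ^+ 2)%:E)%E) ->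
  forall e : R, 0 < e ->
    \forall i \near FF, forall t, D t -> (Rmetric chi (F1 i t) (F2 i t) <= e%:E)%E.
Proof.
move=> FFF H1 H2; apply: (Rmetric_near Hb) => k dl k0 dl0.
have k0' : 0 < k%:R :> R by rewrite ltr0n.
have Ck := cutoff_C1c chi_cutoffs k0.
have [M M0 HM] := C1c_bounded k0' Ck.
have e0 : 0 < dl / M by exact: divr_gt0.
apply: filterS2 H1 (H2 k (dl / M) k0 e0) => i h1 h2 t Dt.
have [d1 d2 l1 l2] := h1 t Dt.
have := Hminus1_norm_cutoff_sub Hb k0' (ltW e0) Ck HM d1 d2 l1 l2 (h2 t Dt).
by rewrite mulrC divfK// gt_eqF.
Qed.

Lemma Rmetric_cvg_L2 (FF : set_system R) {FFF : Filter FF} (F1 : R -> (R -> R) -> R)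
    (F2 : (R -> R) -> R) (psi1 : R -> R -> R) (psi2 : R -> R) :
  (\forall s \near FF, derivative_of (F1 s) (psi1 s) /\ locally_bounded (psi1 s)) ->
  derivative_of F2 psi2 -> locally_bounded psi2 ->
  (forall (k : nat) (e : R), (0 < k)%N -> 0 < e -> \forall s \near FF,
     (\int[mu]_(x in `[(- k%:R)%R, k%:R]) ((psi1 s x - psi2 x) ^+ 2)%:E <= (e ^+ 2)%:E)%E) ->
  Rmetric chi (F1 s) F2 @[s --> FF] --> 0%E.
Proof.
move=> H1 d2 l2 H2; apply: cvg0e_near_le => [s|e e0]; first exact: (Rmetric_ge0 Hb).
(* With [unit] as parameter set the uniform statement becomes a plain limit. *)
have near1 : \forall s \near FF, forall t : unit, setT t -> [/\ derivative_of (F1 s) (psi1 s),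
    derivative_of F2 psi2, locally_bounded (psi1 s) & locally_bounded psi2].
  by apply: filterS H1 => s [].
have near2 (k : nat) (d : R) : (0 < k)%N -> 0 < d -> \forall s \near FF, forall t : unit, setT t ->
    (\int[mu]_(x in `[(- k%:R)%R, k%:R]) ((psi1 s x - psi2 x) ^+ 2)%:E <= (d ^+ 2)%:E)%E.
  by move=> k0 d0; apply: filterS (H2 k d k0 d0).
have := Rmetric_near_L2 FFF near1 near2 e0.
by apply: filterS => s h; exact: (h tt).
Qed.

Section LimitProcess.
Variable F : R -> (R -> R) -> R.
Hypothesis F_derivative : forall t, derivative_of (F t) (fun x => min_value u0 b x t).

Lemma limit_continuous_path : continuous_path (@Hminus1_loc R) (Rmetric chi) F.
Proof.
split=> t t0.
  exact: (derivative_of_Hminus1_loc Hb (F_derivative t) (min_value_locally_bounded t0)).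
apply: (Rmetric_cvg_L2 (psi1 := fun s x => min_value u0 b x s) _ (F_derivative t)).
- apply: (@filterS _ (within `[0, +oo[ (nbhs t)) _ (fun s : R => 0 <= s)) => [s s0|].
    by split=> //; exact: min_value_locally_bounded.
  by apply: nearW => s; rewrite /= in_itv/= andbT.
- exact: min_value_locally_bounded.
- by move=> k e k0 e0; exact: near_min_value_L2.
Qed.

End LimitProcess.

Variables (z : int -> R -> R) (n : nat).
Hypothesis n0 : (0 < n)%N.

(** The value of [zeta_n] at the lattice point i/n for a fixed sample; [step n (fluctuation t)] is
    its version rounded in space. *)
Definition fluctuation (t : R) (i : int) : R :=
  (Num.sqrt n%:R)^-1 * (z i (n%:R * t) - n%:R * hopf_lax u0 (i%:~R / n%:R) t).

Lemma fluctuation_derivative t : derivative_of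
  (fun f => (Num.sqrt n%:R)^-1 * \sum_(i \in [set: int]) (f (i%:~R / n%:R) *
     (z i (n%:R * t) - z (i - 1) (n%:R * t) -
      (n%:R * hopf_lax u0 (i%:~R / n%:R) t - n%:R * hopf_lax u0 ((i - 1)%:~R / n%:R) t))))
  (step n (fluctuation t)).
Proof. by apply: step_derivative => // i; rewrite /fluctuation; ring. Qed.

Hypothesis z_cadlag : forall i, cadlag setT (@real_dist R) (z i).

Lemma at_right_scale (t : R) : n%:R * s @[s --> t^'+] --> (n%:R * t)^'+.
Proof.
have n0' : 0 < n%:R :> R by rewrite ltr0n.
move=> U nU; have h : \forall s \near t, n%:R * t < n%:R * s -> U (n%:R * s).
  have c : continuous (fun s : R => n%:R * s) by move=> s; apply: cvgMr; exact: cvg_id.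
  exact: (c t _ nU).
by apply: filterS h => s h ts; apply: h; rewrite ltr_pM2l.
Qed.

Lemma at_left_scale (t : R) : n%:R * s @[s --> t^'-] --> (n%:R * t)^'-.
Proof.
have n0' : 0 < n%:R :> R by rewrite ltr0n.
move=> U nU; have h : \forall s \near t, n%:R * s < n%:R * t -> U (n%:R * s).
  have c : continuous (fun s : R => n%:R * s) by move=> s; apply: cvgMr; exact: cvg_id.
  exact: (c t _ nU).
by apply: filterS h => s h ts; apply: h; rewrite ltr_pM2l.
Qed.

Lemma real_dist_cvg (FF : set_system R) (f : R -> R) (l : R) : Filter FF ->
  real_dist (f s) l @[s --> FF] --> 0%E -> f s @[s --> FF] --> l.
Proof.
move=> FFF h; apply/cvgrPdist_le => e e0.
by have := near_lt_cvg0e FFF h e0; apply: filterS => s; rewrite /real_dist lte_fin distrC => /ltW.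
Qed.

Lemma at_right_nonneg (t : R) : 0 <= t -> t^'+ `=>` within `[0, +oo[ (nbhs t).
Proof.
move=> t0 U nU; have h : \forall s \near t, `[0, +oo[%classic s -> U s := nU.
have : \forall s \near t, t < s -> U s.
  by apply: filterS h => s h ts; apply: h; rewrite /= in_itv/= andbT (le_trans t0)// ltW.
exact.
Qed.

Lemma at_left_nonneg (t : R) : 0 < t -> t^'- `=>` within `[0, +oo[ (nbhs t).
Proof.
move=> t0 U nU; have h : \forall s \near t, `[0, +oo[%classic s -> U s := nU.
have : \forall s \near t, s < t -> U s.
  by apply: filterS2 h (lt_nbhsr t0) => s h s0 _; apply: h; rewrite /= in_itv/= andbT ltW.
exact.
Qed.

Variable F : R -> (R -> R) -> R.
Hypothesis F_derivative : forall t, derivative_of (F t) (step n (fluctuation t)).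

(** One-sided limits can be taken coefficient by coefficient: particle positions have them, and the
    Hopf-Lax solution is continuous in time. *)
Lemma fluctuation_cadlag : cadlag (@Hminus1_loc R) (Rmetric chi) F.
Proof.
split=> t t0.
- exact: (derivative_of_Hminus1_loc Hb (F_derivative t) (step_locally_bounded _ _)).
- apply: (Rmetric_cvg_L2 (psi1 := fun s => step n (fluctuation s)) _ (F_derivative t)).
  + by apply: nearW => s; split=> //; exact: step_locally_bounded.
  + exact: step_locally_bounded.
  move=> k d k0 d0; apply: near_step_L2 => // i.
  apply: cvgMr; apply: cvgB.
    have [_ zr _] := z_cadlag i.
    apply: (cvg_comp _ _ (at_right_scale (t := t))).
    by apply: real_dist_cvg; apply: zr; rewrite mulr_ge0.
  apply: cvgMr; apply: cvg_trans (hopf_lax_time_cvg (x := _) t0).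
  by apply: cvg_app; exact: at_right_nonneg.
have nt0 : 0 < n%:R * t by rewrite mulr_gt0// ltr0n.
have L i : exists l : R, z i s @[s --> (n%:R * t)^'-] --> l.
  have [_ _ zl] := z_cadlag i; have [l _ h] := zl _ nt0.
  by exists l; exact: real_dist_cvg.
pose l i := sval (cid (L i)).
have lP i : z i s @[s --> (n%:R * t)^'-] --> l i by rewrite /l; case: cid.
(* The left limit is the derivative of the step function built from the left limits of the
   particles, so it lies in the state space. *)
pose cl (i : int) : R := (Num.sqrt n%:R)^-1 * (l i - n%:R * hopf_lax u0 (i%:~R / n%:R) t).
pose G (f : R -> R) : R := - \int[mu]_x (derive1 f x * step n cl x).
have Gd : derivative_of G (step n cl) by [].
exists G; first exact: (derivative_of_Hminus1_loc Hb Gd (step_locally_bounded _ _)).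
apply: (Rmetric_cvg_L2 (psi1 := fun s => step n (fluctuation s)) _ Gd).
- by apply: nearW => s; split=> //; exact: step_locally_bounded.
- exact: step_locally_bounded.
move=> k d k0 d0; apply: near_step_L2 => // i.
apply: cvgMr; apply: cvgB.
  exact: (cvg_comp _ _ (at_left_scale (t := t)) (lP i)).
apply: cvgMr; apply: cvg_trans (hopf_lax_time_cvg (x := _) (ltW t0)).
by apply: cvg_app; exact: at_left_nonneg.
Qed.

End DeterministicLimit.

(** * Uniform convergence on compact time intervals *)

Section UniformLimit.
Context {R : realType}.
Notation mu := (@lebesgue_measure R).
Variables (u0 b : R -> R) (chi : nat -> R -> R).
Hypotheses (cont : continuous u0) (mono : {homo u0 : x y / x <= y})
  (boxes : forall K T, 0 < K -> 0 < T -> exists Y M, hopf_lax_box u0 K T Y M)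
  (bcont : continuous b) (chi_cutoffs : cutoffs chi).

Lemma continuous_path_cadlag (T : Type) (E : set T) (r : T -> T -> \bar R) (x : R -> T) :
  continuous_path E r x -> cadlag E r x.
Proof.
move=> [Ex cx]; split=> // t t0.
  by apply: cvg_trans (cx t t0); apply: cvg_app; exact: at_right_nonneg.
exists (x t); first exact/Ex/ltW.
by apply: cvg_trans (cx t (ltW t0)); apply: cvg_app; exact: at_left_nonneg.
Qed.

Variable z : nat -> int -> R -> R.

(** [zeta_n] at a fixed sample. *)
Definition rescaled (n : nat) (x t : R) : R := (Num.sqrt n%:R)^-1 *
  (z n (Num.floor (n%:R * x)) (n%:R * t) - n%:R * hopf_lax u0 x t).

Lemma rescaled_locally_bounded n t : 0 <= t -> locally_bounded (fun x => rescaled n x t).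
Proof.
move=> t0; apply: locally_boundedZ; apply: locally_boundedB.
  exact: (step_locally_bounded n (fun i => z n i (n%:R * t))).
exact/locally_boundedZ/continuous_locally_bounded/(hopf_lax_continuous cont mono boxes).
Qed.

(* The spatial Lipschitz bound on the Hopf-Lax solution controls the rounding
   of x to the lattice Z/n. *)
Lemma step_rescaled_le (k : nat) (T : R) : (0 < k)%N -> 0 < T -> exists2 L : R, 0 <= L &
  forall n x t, (0 < n)%N -> `|x| <= k%:R -> 0 <= t -> t <= T ->
    (step n (fluctuation u0 (z n) n t) x - rescaled n x t) ^+ 2 <= L ^+ 2 / n%:R.
Proof.
move=> k0 T0; have k0' : 0 < k%:R :> R by rewrite ltr0n.
have [L L0 [HL _]] := hopf_lax_lipschitz cont mono boxes k0' T0.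
exists L => // n x t n0 xk t0 tT; have n0' : 0 < n%:R :> R by rewrite ltr0n.
have flk := floor_bound n xk.
rewrite /step /fluctuation /rescaled; set i := Num.floor (n%:R * x) in flk *.
have /andP[i1 i2] : i%:~R <= n%:R * x < (i + 1)%:~R by exact: floor_itv.
have xin : `|x - i%:~R / n%:R| <= n%:R^-1.
  have e1 : x - i%:~R / n%:R = (n%:R * x - i%:~R) / n%:R by field; rewrite gt_eqF.
  rewrite e1 normrM normfV (gtr0_norm n0') ler_piMl ?invr_ge0 ?(ltW n0')//.
  rewrite ger0_norm ?subr_ge0//; move: i2; rewrite intrD; lra.
(* Rounding down cannot leave [-k, k], because -k is itself a lattice point. *)
have ik : `|i%:~R / n%:R : R| <= k%:R.
  rewrite normrM normfV (gtr0_norm n0') ler_pdivrMr// -natrM -intr_norm.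
  by rewrite -abszE pmulrn ler_int lez_nat mulnC.
have h := HL _ _ t xk ik t0 tT.
rewrite -mulrBr opprB addrC subrKA -mulrBr exprMn exprVn sqr_sqrtr// mulrC.
rewrite ler_pM2r ?invr_gt0// -(@real_normK _ (_ * _)) ?num_real//.
rewrite lerXn2r ?nnegrE// normrM (gtr0_norm n0').
apply: (@le_trans _ _ (n%:R * (L * n%:R^-1))).
  by rewrite ler_wpM2l// (le_trans h)// ler_wpM2l.
by rewrite mulrCA mulfV ?mulr1// gt_eqF.
Qed.

Hypothesis cvg_L2 : forall k N : nat,
  ereal_sup [set (\int[mu]_(x in `[(- k.+1%:R)%R, k.+1%:R])
     ((`|rescaled n x t - min_value u0 b x t| `^ 2)%:E))%E | t in `[0, N.+1%:R]]
    @[n --> \oo] --> 0%E.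

(** The square of the total error is at most twice the sum of the squares of the error in (2) and
    the rounding error. The first part gives 2 (e^2 / 4); the second, over length 2k, gives 4 k L^2
    / n, which is at most e^2 / 2 once n >= 8 k L^2 / e^2. *)
Lemma near_fluctuation_L2 (k N : nat) (e : R) : (0 < k)%N -> 0 < e ->
  \forall n \near \oo, forall t, 0 <= t <= N.+1%:R ->
    (\int[mu]_(x in `[(- k%:R)%R, k%:R])
      ((step n (fluctuation u0 (z n) n t) x - min_value u0 b x t) ^+ 2)%:E <= (e ^+ 2)%:E)%E.
Proof.
case: k => // k _ e0.
have [L L0 HL] := @step_rescaled_le k.+1 N.+1%:R isT (ltr0Sn _ _).
have e4 : 0 < e ^+ 2 / 4 by rewrite divr_gt0// exprn_gt0.
have nearS : \forall n \near \oo, (ereal_sup [set (\int[mu]_(x in `[(- k.+1%:R)%R, k.+1%:R])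
    ((`|rescaled n x t - min_value u0 b x t| `^ 2)%:E))%E | t in `[0%R, (N.+1%:R)%R]]
    < (e ^+ 2 / 4)%:E)%E by apply: near_lt_cvg0e.
have nearn : \forall n \near \oo, 8 * k.+1%:R * L ^+ 2 / e ^+ 2 <= n%:R :> R.
  exact: nbhs_infty_ger.
have near0 : \forall n \near \oo, (0 < n)%N by exact: nbhs_infty_gt.
apply: filterS3 nearS nearn near0 => n hS hn n0 t /andP[t0 tN].
have n0' : 0 < n%:R :> R by rewrite ltr0n.
pose D : set R := `[- k.+1%:R, k.+1%:R]%classic.
have mD : measurable D by exact: measurable_itv.
have k0' : 0 < k.+1%:R :> R by [].
have lZ := min_value_locally_bounded cont boxes bcont t0.
have lr := rescaled_locally_bounded n t0.
have lrZ := locally_bounded_sqr (locally_boundedB lr lZ).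
have lsZ := locally_bounded_sqr (locally_boundedB (step_locally_bounded n (fluctuation u0 (z n) n t)) lZ).
pose I := \int[mu]_(x in D) ((rescaled n x t - min_value u0 b x t) ^+ 2).
have IE : I < e ^+ 2 / 4.
  rewrite -lte_fin; apply: le_lt_trans hS.
  apply: ereal_sup_ubound; exists t; first by rewrite /= in_itv/= t0.
  rewrite /I EFin_Rintegral//; last exact: locally_bounded_integrable.
  by apply: eq_integral => x _; rewrite powR_mulrn// real_normK// num_real.
rewrite -EFin_Rintegral//; last exact: locally_bounded_integrable.
have lsum : locally_bounded (fun x => 2 * (rescaled n x t - min_value u0 b x t) ^+ 2 + 2 * (L ^+ 2 / n%:R)).
  have l1 := locally_boundedZ 2 lrZ.
  have l2 : locally_bounded (fun x : R => - (2 * (L ^+ 2 / n%:R))).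
    by split=> // K; exists `|- (2 * (L ^+ 2 / n%:R))|.
  have -> : (fun x => 2 * (rescaled n x t - min_value u0 b x t) ^+ 2 + 2 * (L ^+ 2 / n%:R)) =
      (fun x => 2 * (rescaled n x t - min_value u0 b x t) ^+ 2 - - (2 * (L ^+ 2 / n%:R))).
    apply/funext => x; congr (_ + _).
    by rewrite opprK.
  exact: locally_boundedB l1 l2.
rewrite lee_fin.
apply: (@le_trans _ _ (\int[mu]_(x in D)
    (2 * (rescaled n x t - min_value u0 b x t) ^+ 2 + 2 * (L ^+ 2 / n%:R)))).
  apply: le_Rintegral => //; [exact: locally_bounded_integrable..|].
  move=> x; rewrite /D/= in_itv/= -ler_norml => xk.
  have := HL n x t n0 xk t0 tN.
  set s := step _ _ _; set r := rescaled _ _ _; set Z := min_value _ _ _ _ => h.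
  have := sqr_ge0 ((s - r) - (r - Z)); nra.
have iI := locally_bounded_integrable (- k.+1%:R) k.+1%:R lrZ.
rewrite RintegralD//; [|exact: integrable_scale|]; last first.
  by apply: integrable_cst_fin => //; exact: itv_finite_measure.
rewrite RintegralZl// -/I.
have c1 : \int[mu]_(x in D) (2 * (L ^+ 2 / n%:R)) <= 2 * (L ^+ 2 / n%:R) * (k.+1%:R - - k.+1%:R).
  apply: Rintegral_itv_le => //; last by move: k0'; lra.
  by split=> // K; exists `|2 * (L ^+ 2 / n%:R)|.
have c2 : 8 * k.+1%:R * L ^+ 2 / n%:R <= e ^+ 2.
  by move: hn; rewrite ler_pdivrMr ?exprn_gt0// => hn; rewrite ler_pdivrMr// (mulrC (e ^+ 2)).
have c3 : 2 * (L ^+ 2 / n%:R) * (k.+1%:R - - k.+1%:R) = (8 * k.+1%:R * L ^+ 2 / n%:R) / 2.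
  by field; rewrite gt_eqF.
rewrite c3 in c1; lra.
Qed.

Variables (F : nat -> R -> (R -> R) -> R) (F0 : R -> (R -> R) -> R).
Hypotheses (F_derivative : forall n t, (0 < n)%N ->
    derivative_of (F n t) (step n (fluctuation u0 (z n) n t)))
  (F0_derivative : forall t, derivative_of (F0 t) (fun x => min_value u0 b x t)).

Lemma near_Rmetric_le (N : nat) (e : R) : 0 < e ->
  \forall n \near \oo, forall t, 0 <= t <= N.+1%:R -> (Rmetric chi (F n t) (F0 t) <= e%:E)%E.
Proof.
apply: (@Rmetric_near_L2 _ chi chi_cutoffs nat R \oo [set t | 0 <= t <= N.+1%:R] F (fun _ => F0)
  (fun n t => step n (fluctuation u0 (z n) n t)) (fun _ t x => min_value u0 b x t)).
  have near0 : \forall n \near \oo, (0 < n)%N by exact: nbhs_infty_gt.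
  apply: filterS near0 => n n0 t /= /andP[t0 _]; split.
  - exact: F_derivative.
  - exact: F0_derivative.
  - exact: step_locally_bounded.
  - exact: min_value_locally_bounded.
by move=> k d k0 d0; exact: near_fluctuation_L2.
Qed.

Lemma sup_Rmetric_cvg (T : R) : 0 <= T ->
  ereal_sup [set Rmetric chi (F n t) (F0 t) | t in `[0, T]] @[n --> \oo] --> 0%E.
Proof.
move=> T0; apply: cvg0e_near_le => [n|e e0].
  apply: (le_trans (Rmetric_ge0 (cutoff_is_bump chi_cutoffs) chi (F n 0) (F0 0))).
  by apply: ereal_sup_ubound; exists 0 => //=; rewrite in_itv/= lexx.
have := near_Rmetric_le (Num.truncn T) e0; apply: filterS => n h.
apply: ge_ereal_sup => _ [t /= + <-]; rewrite in_itv/= => /andP[t0 tT]; apply: h.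
by rewrite t0 (le_trans tT)// ltW// truncnS_gt.
Qed.

Lemma skorokhod_dist_cvg :
  skorokhod_dist (Rmetric chi) (F n) F0 @[n --> \oo] --> 0%E.
Proof.
apply: cvg0e_near_le => [n|e e0]; first exact: skorokhod_dist_ge0.
have e2 : 0 < e / 2 by rewrite divr_gt0.
(* The horizon N + 1 exceeds 2 / e, so exp(-(N + 1)) <= 1 / (N + 2) <= e / 2. *)
pose N := Num.truncn (e / 2)^-1.
have HN : expR (- N.+1%:R) <= e / 2.
  rewrite expRN -[leRHS]invrK lef_pV2 ?posrE ?expR_gt0 ?invr_gt0//.
  apply: (@le_trans _ _ (1 + N.+1%:R)); last exact: expR_ge1Dx.
  by rewrite (le_trans (ltW (truncnS_gt _)))// lerDr.
have := near_Rmetric_le N e2; apply: filterS => n h.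
apply: (le_trans (@skorokhod_dist_le R _ (Rmetric chi) (F n) F0 N.+1%:R (e / 2) _ (ltW e2) _ _)).
- by [].
- exact: (Rmetric_ge0 (cutoff_is_bump chi_cutoffs)).
- by move=> t t0 tN; apply: h; rewrite t0.
- by rewrite lee_fin; lra.
Qed.

End UniformLimit.

Theorem theorem2p5 (R : realType) (d : measure_display)
    (Omega : measurableType d) (P : probability Omega R)
    (rho0 u0 : R -> R) (z : nat -> int -> R -> Omega -> R)
    (B : R -> Omega -> R) (chi : nat -> R -> R) (tau : R)
    (rho0_ge0 : forall x, 0 <= rho0 x)
    (rho0_loc_bounded :
       forall K : set R, compact K -> [bounded rho0 x | x in K])
    (rho0_measurable : measurable_fun setT rho0)
    (rho0_growth : exists b : R,
       `|r|^-1 * sup [set rho0 x | x in `[r, b]] @[r --> -oo] --> (0 : R))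
    (u0_0 : u0 0 = 0)
    (u0_rho0 : forall x y, y < x ->
       u0 x - u0 y = \int[lebesgue_measure]_(r in `[y, x]) rho0 r)
    (z_hammersley : forall n, (0 < n)%N -> hammersley_process P (z n))
    (z_origin : forall n, (0 < n)%N -> {ae P, forall w, z n 0 0 w = 0})
    (eta_indep : forall n, (0 < n)%N ->
       mutually_independent P (fun i w => eta z n i 0 w))
    (eta_exponential : forall n i, (0 < n)%N ->
       has_exponential_law P (fun w => eta z n i 0 w)
         (n%:R * \int[lebesgue_measure]_(x in
                    `[(i - 1)%:~R / n%:R, i%:~R / n%:R]) rho0 x))
    (B_brownian : two_sided_brownian P B)
    (cvg_compact : forall A : set (R * R), compact A -> A !=set0 ->
       A `<=` [set p | 0 <= p.2] ->
       finite_set A \/ (forall p, A p -> yminus u0 p.1 p.2 = yplus u0 p.1 p.2) ->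
       {ae P, forall w,
          ereal_sup [set (`|zeta_n u0 z n p.1 p.2 w
                            - zeta rho0 u0 B p.1 p.2 w|)%:E | p in A]
            @[n --> \oo] --> 0%E})
    (cvg_Lp : forall a b T p : R, a < b -> 0 < T -> 1 <= p ->
       {ae P, forall w,
          ereal_sup [set (\int[lebesgue_measure]_(x in `[a, b])
                            ((`|zeta_n u0 z n x t w
                                - zeta rho0 u0 B x t w| `^ p)%:E))%E
                    | t in `[0, T]]
            @[n --> \oo] --> 0%E})
    (chi_cutoffs : cutoffs chi)
    (tau_ge0 : 0 <= tau) :
  {ae P, forall w,
     ereal_sup [set Rmetric chi (xi_n u0 z w n t) (xi rho0 u0 B w t)
               | t in `[0, tau]]
       @[n --> \oo] --> 0%E} /\
  {ae P, forall w,
     continuous_path Hminus1_loc (Rmetric chi) (xi rho0 u0 B w) /\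
     skorokhod_cvg Hminus1_loc (Rmetric chi)
       (xi_n u0 z w) (xi rho0 u0 B w)}.
Proof.
have ucont := u0_continuous rho0_ge0 rho0_loc_bounded rho0_measurable u0_rho0.
have umono := u0_nondecreasing rho0_ge0 u0_rho0.
have uboxes := u0_boxes rho0_loc_bounded rho0_measurable rho0_growth u0_rho0.
(* The time-changed path, continuous in y; it turns [zeta] into [min_value] for each sample. *)
pose b w y := B (signed_integral (fun s => rho0 s ^+ 2) 0 y) w.
have ae_b : {ae P, forall w, continuous (b w)}.
  apply: filterS (ae_two_sided_brownian_continuous B_brownian) => w cB y.
  apply: (continuous_comp (f := signed_integral (fun s => rho0 s ^+ 2) 0) (g := B ^~ w)).
    exact: (signed_integral_continuous (rho0_sqr_locally_bounded rho0_loc_bounded rho0_measurable)).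
  exact: cB.
have ae_z : {ae P, forall w, forall n, (0 < n)%N -> forall k, cadlag setT (@real_dist R) (fun t => z n k t w)}.
  apply: ae_foralln => -[|n]; first exact: aeW.
  by have [h _] := z_hammersley n.+1 isT; apply: filterS h.
(* The exceptional set in (2) depends on the box. Integer boxes are countably many and exhaust all,
   so one event serves them simultaneously. *)
have ae_L2 : {ae P, forall w, forall k N : nat,
    ereal_sup [set (\int[lebesgue_measure]_(x in `[(- k.+1%:R)%R, k.+1%:R])
      ((`|rescaled u0 (fun n i t => z n i t w) n x t - min_value u0 (b w) x t| `^ 2)%:E))%E
      | t in `[0, N.+1%:R]] @[n --> \oo] --> 0%E}.
  apply: ae_foralln => k; apply: ae_foralln => N.
  apply: (cvg_Lp (- k.+1%:R) k.+1%:R N.+1%:R 2) => //; last lra.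
  by rewrite -subr_gt0 opprK addr_gt0.
have xi_n_der w n t : (0 < n)%N -> derivative_of (xi_n u0 z w n t)
    (step n (fluctuation u0 (fun i t => z n i t w) n t)).
  by move=> n0; exact: (fluctuation_derivative u0 (fun i t => z n i t w) n0 t).
(* [zeta] unfolds to [min_value] of [b w], so [xi] is a derivative by definition. *)
have xi_der w t : derivative_of (xi rho0 u0 B w t) (fun x => min_value u0 (b w) x t) by [].
split.
  apply: filterS2 ae_b ae_L2 => w cb L2w.
  exact: (sup_Rmetric_cvg ucont umono uboxes cb chi_cutoffs L2w (fun n t => xi_n_der w n t) (xi_der w) tau_ge0).
apply: filterS3 ae_b ae_z ae_L2 => w cb cz L2w.
have xi_cont := limit_continuous_path ucont uboxes cb chi_cutoffs (xi_der w).
split=> //; split.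
- move=> n n0; apply: (fluctuation_cadlag ucont umono uboxes chi_cutoffs n0 (cz n n0)).
  by move=> t; exact: xi_n_der.
- exact: continuous_path_cadlag.
- exact: (skorokhod_dist_cvg ucont umono uboxes cb chi_cutoffs L2w (fun n t => xi_n_der w n t) (xi_der w)).
Qed.
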